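(* Let $f:\mathbb{R}^n\to\mathbb{R}$ and $h:\mathbb{R}^n\to\mathbb{R}^m$ be differentiable, possibly non-convex functions, and assume $\operatorname{rank}J_h(x)=m$ for all $x\in\mathbb{R}^n$. Consider the problem $\min_{x\in\mathbb{R}^n} f(x)$ subject to $h(x)=0$, and let $(x^\star,\lambda^\star)\in\mathbb{R}^n\times\mathbb{R}^m$ be a stationary point of it, i.e. $\nabla f(x^\star)+J_h(x^\star)^\top\lambda^\star=0$ and $h(x^\star)=0$. Let the second-order sufficient conditions hold at $(x^\star,\lambda^\star)$, i.e. $$v^\top H_{xx}\mathcal{L}(x^\star,\lambda^\star)\,v>0\quad\text{for every nonzero } v\in\mathbb{R}^n \text{ such that } J_h(x^\star)v=0.$$ Then the local minimum $x^\star$ is a locally asymptotically stable equilibrium point of the FL-CMO dynamics $$\dot x=-\nabla f(x)+J_h(x)^\top\left(J_h(x)J_h(x)^\top\right)^{-1}\left(J_h(x)\nabla f(x)+\mathcal{G}(y)\right),\qquad y=h(x),$$ where the controller $\mathcal{G}$ is designed as described in the context.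
   Context: $J_h(x)\in\mathbb{R}^{m\times n}$ is the Jacobian matrix of $h$ at $x$. The Lagrangian is $\mathcal{L}(x,\lambda)=f(x)+\lambda^\top h(x)$, and $H_{xx}\mathcal{L}(x,\lambda)$ is its Hessian matrix with respect to $x$. When the second-order sufficient conditions hold, $x^\star$ is a strict local minimum of the problem. FL-CMO (feedback-linearization controlled multipliers optimization) is the closed loop of the system with state $x(t)\in\mathbb{R}^n$, input $\lambda(t)\in\mathbb{R}^m$ and output $y(t)\in\mathbb{R}^m$ given by $\dot x=-\nabla f(x)-J_h(x)^\top\lambda$, $y=h(x)$, with the control law $\lambda=A(x)^{-1}(-b(x)+v)$, where $A(x)=-J_h(x)J_h(x)^\top$, $b(x)=-J_h(x)\nabla f(x)$ and $v(t)=\mathcal{G}(y(t))\in\mathbb{R}^m$. Under this law the relation between $v$ and $y$ is linear and decoupled: $\dot y_i=v_i$ for $i=1,\dots,m$. The controller $\mathcal{G}$ (static or dynamic) is designed so that the closed loop of $\dot y=v$ with $v=\mathcal{G}(y)$ is asymptotically stable and $y(t)\to0$; the simplest example is $v_i=-K_iy_i$ with $K_i>0$, $i=1,\dots,m$. *)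

(* Defs.v *)
From HB Require Import structures.
From mathcomp Require Import all_boot all_order all_algebra.
From mathcomp Require Import all_classical all_reals all_analysis.

Set Implicit Arguments.
Unset Strict Implicit.
Unset Printing Implicit Defensive.

Import Order.TTheory GRing.Theory Num.Theory.
Import numFieldNormedType.Exports.

Local Open Scope classical_set_scope.
Local Open Scope ring_scope.

(* The library's jacobian acts on row vectors (it is the transpose of the usual
   Jacobian matrix); here points are column vectors and jac g x is the m x n
   matrix with entries d g_i / d x_j. *)
Definition grad (R : realType) (n : nat) (g : 'cV[R]_n -> R) (x : 'cV[R]_n) :
    'cV[R]_n :=
  \col_(i < n) 'D_(delta_mx i 0) g x.

Definition jac (R : realType) (n m : nat) (g : 'cV[R]_n -> 'cV[R]_m)
    (x : 'cV[R]_n) : 'M[R]_(m, n) :=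
  \matrix_(i < m, j < n) ('D_(delta_mx j 0) g x) i 0.

Definition hessian (R : realType) (n : nat) (g : 'cV[R]_n -> R) (x : 'cV[R]_n) :
    'M[R]_n :=
  jac (grad g) x.

Definition lagrangian (R : realType) (n m : nat) (f : 'cV[R]_n -> R)
    (h : 'cV[R]_n -> 'cV[R]_m) (lambda : 'cV[R]_m) (x : 'cV[R]_n) : R :=
  f x + (lambda^T *m h x) 0 0.

Definition stationary (R : realType) (n m : nat) (f : 'cV[R]_n -> R)
    (h : 'cV[R]_n -> 'cV[R]_m) (x : 'cV[R]_n) (lambda : 'cV[R]_m) : Prop :=
  grad f x + (jac h x)^T *m lambda = 0 /\ h x = 0.

Definition second_order_sufficient (R : realType) (n m : nat)
    (f : 'cV[R]_n -> R) (h : 'cV[R]_n -> 'cV[R]_m)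
    (x : 'cV[R]_n) (lambda : 'cV[R]_m) : Prop :=
  forall v : 'cV[R]_n, v != 0 -> jac h x *m v = 0 ->
    0 < (v^T *m hessian (lagrangian f h lambda) x *m v) 0 0.

(* x solves x' = F x on [0, T[, where T may be +oo: it is right-continuous at 0
   and satisfies the equation on ]0, T[.  Values at negative times are
   irrelevant. *)
Definition is_solution (R : realType) (V : normedModType R) (F : V -> V)
    (T : \bar R) (x : R -> V) : Prop :=
  x @ 0^'+ --> x 0 /\
  forall t : R, 0 < t -> (t%:E < T)%E -> is_derive t 1 x (F (x t)).

Definition lyapunov_stable (R : realType) (V : normedModType R) (F : V -> V)
    (xe : V) : Prop :=
  forall eps : R, 0 < eps -> exists2 delta : R, 0 < delta &
    forall (T : \bar R) (x : R -> V), is_solution F T x ->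
      `|x 0 - xe| < delta ->
      forall t : R, 0 <= t -> (t%:E < T)%E -> `|x t - xe| < eps.

Definition locally_attractive (R : realType) (V : normedModType R) (F : V -> V)
    (xe : V) : Prop :=
  exists2 delta : R, 0 < delta &
    forall x : R -> V, is_solution F +oo%E x ->
      `|x 0 - xe| < delta -> x t @[t --> +oo] --> xe.

Definition locally_complete (R : realType) (V : normedModType R) (F : V -> V)
    (xe : V) : Prop :=
  exists2 delta : R, 0 < delta &
    forall x0 : V, `|x0 - xe| < delta ->
      exists2 x : R -> V, is_solution F +oo%E x & x 0 = x0.

(* F is not assumed to be locally Lipschitz, so that solutions need not be
   unique: stability and attractivity are required of every solution, and
   locally_complete makes these requirements non-vacuous. *)
Definition locally_asymptotically_stable (R : realType) (V : normedModType R)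
    (F : V -> V) (xe : V) : Prop :=
  [/\ F xe = 0, lyapunov_stable F xe, locally_attractive F xe &
      locally_complete F xe].

(* An output-feedback controller v = G(y) with internal state z in R^p:
     z' = ctrl_field (y, z),   v = ctrl_out (y, z).
   Static controllers are those with p = 0, where 'cV_0 is a one-point space. *)
Record controller (R : realType) (m p : nat) := Controller {
  ctrl_field : 'cV[R]_m * 'cV[R]_p -> 'cV[R]_p ;
  ctrl_out : 'cV[R]_m * 'cV[R]_p -> 'cV[R]_m
}.

(* y' = v in closed loop with v = G(y); the state is (y, z). *)
Definition integrator_loop (R : realType) (m p : nat) (G : controller R m p)
    (w : 'cV[R]_m * 'cV[R]_p) : 'cV[R]_m * 'cV[R]_p :=
  (ctrl_out G w, ctrl_field G w).

Definition stabilizing_controller (R : realType) (m p : nat)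
    (G : controller R m p) (ze : 'cV[R]_p) : Prop :=
  [/\ continuous (ctrl_field G), continuous (ctrl_out G) &
      locally_asymptotically_stable (integrator_loop G) (0, ze)].

Definition flcmo_input (R : realType) (n m : nat) (f : 'cV[R]_n -> R)
    (h : 'cV[R]_n -> 'cV[R]_m) (x : 'cV[R]_n) (v : 'cV[R]_m) : 'cV[R]_n :=
  let J := jac h x in
  - grad f x + J^T *m invmx (J *m J^T) *m (J *m grad f x + v).

(* The FL-CMO closed loop; the state is (x, z), with z the controller state. *)
Definition flcmo (R : realType) (n m p : nat) (f : 'cV[R]_n -> R)
    (h : 'cV[R]_n -> 'cV[R]_m) (G : controller R m p)
    (s : 'cV[R]_n * 'cV[R]_p) : 'cV[R]_n * 'cV[R]_p :=
  let y := h s.1 in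
  (flcmo_input f h s.1 (ctrl_out G (y, s.2)), ctrl_field G (y, s.2)).

(* Main.v *)
Require Import Defs.
From HB Require Import structures.
From mathcomp Require Import all_boot all_order all_algebra.
From mathcomp Require Import all_classical all_reals all_analysis.
From mathcomp Require Import ring lra.

(* On {h = 0} the flow projects -grad L onto the tangent space, since the
   projector P(x) = 1 - J^T (J J^T)^-1 J annihilates J^T ls.  The pair (h x, z)
   solves the integrator loop whatever x does, hence it is small and tends to
   equilibrium.  The square norm W of the tangential deviation
   xi = P(xs) (x - xs) satisfies W' <= - c mu^2 as long as W >= mu^2 and y, v are
   O(mu), because xi lies in the kernel of J(xs), where the Hessian of L is
   coercive; and |x - xs| is bounded by |xi| + |h x| near xs.  Stability follows
   by trapping and attractivity by letting mu tend to 0.  Solutions exist by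
   Peano's theorem for the field composed with a retraction onto a ball, which
   stability keeps them in. *)

Set Implicit Arguments.
Unset Strict Implicit.
Unset Printing Implicit Defensive.

Import Order.TTheory GRing.Theory Num.Theory.
Import numFieldNormedType.Exports.

Local Open Scope classical_set_scope.
Local Open Scope ring_scope.

(** The controller is merely continuous and its loop converges at no prescribed rate, so neither a
    linearization of the closed loop nor a Lyapunov function for the pair (h x, z) is at hand. This
    is why the decay of W carries a threshold mu: it asks only that h x and v be small compared with
    mu, not that they decrease in a given way, and its constants do not depend on mu. Above the
    threshold mu is at most a constant times |xi|, so every error term is a small multiple of |xi|^2
    and is absorbed by the coercive term. The field is only known to be continuous near the
    equilibrium and solutions may branch, so all estimates are made along an arbitrary solution on
    [0, T[. *)

(** * Limits and norms of matrices *)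

Lemma mx_norm_leP (R : realType) m n (M : 'M[R]_(m, n)) (e : R) :
  0 <= e -> (`|M| <= e) <-> (forall i j, `|M i j| <= e).
Proof.
move=> e0; rewrite [leLHS]/Num.Def.normr /= mx_normrE; split.
  by move=> /bigmax_leP[_ H] i j; exact: (H (i, j)).
by move=> H; apply/bigmax_leP; split=> // -[i j] _; exact: H.
Qed.

Lemma mx_entry_le (R : realType) m n (M : 'M[R]_(m, n)) i j :
  `|M i j| <= `|M|.
Proof. by move: i j; apply/mx_norm_leP. Qed.

Lemma cvg_mx (R : realType) (T : Type) (F : set_system T) (FF : Filter F) m n
    (g : T -> 'M[R]_(m, n)) (M : 'M[R]_(m, n)) :
  (forall i j, g x i j @[x --> F] --> M i j) -> g @ F --> M.
Proof.
move=> H; apply/cvgrPdist_le => e e0.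
have K : forall ij : 'I_m * 'I_n,
    \forall x \near F, `|M ij.1 ij.2 - g x ij.1 ij.2| <= e.
  by move=> -[i j]; move: (H i j) => /cvgrPdist_le; exact.
apply: (filterS _ (filter_forall _ K)) => x Hx.
apply/mx_norm_leP; first exact: ltW.
by move=> i j; rewrite !mxE; exact: (Hx (i, j)).
Qed.

Lemma cvg_entry (R : realType) (T : Type) (F : set_system T) (FF : Filter F)
    m n (g : T -> 'M[R]_(m, n)) (M : 'M[R]_(m, n)) i j :
  g @ F --> M -> g x i j @[x --> F] --> M i j.
Proof. by move=> H; exact: (cvg_comp _ _ H (@coord_continuous R m n i j M)). Qed.

Lemma cvg_sumr (R : realType) (T : Type) (F : set_system T) (FF : Filter F)
    (I : Type) (r : seq I) (P : pred I) (g : I -> T -> R) (l : I -> R) :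
  (forall i, g i x @[x --> F] --> l i) ->
  \sum_(i <- r | P i) g i x @[x --> F] --> \sum_(i <- r | P i) l i.
Proof.
move=> H; elim: r => [|i r IH].
  by under eq_fun do rewrite big_nil; rewrite big_nil; exact: cvg_cst.
under eq_fun do rewrite big_cons; rewrite big_cons.
by case: (P i) => //; exact: cvgD.
Qed.

Lemma cvg_prodr (R : realType) (T : Type) (F : set_system T) (FF : Filter F)
    (I : Type) (r : seq I) (P : pred I) (g : I -> T -> R) (l : I -> R) :
  (forall i, g i x @[x --> F] --> l i) ->
  \prod_(i <- r | P i) g i x @[x --> F] --> \prod_(i <- r | P i) l i.
Proof.
move=> H; elim: r => [|i r IH].
  by under eq_fun do rewrite big_nil; rewrite big_nil; exact: cvg_cst.
under eq_fun do rewrite big_cons; rewrite big_cons.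
by case: (P i) => //; exact: cvgM.
Qed.

Lemma cvg_trmx (R : realType) (T : Type) (F : set_system T) (FF : Filter F)
    m n (g : T -> 'M[R]_(m, n)) (M : 'M[R]_(m, n)) :
  g @ F --> M -> (fun x => (g x)^T) @ F --> M^T.
Proof.
move=> H; apply: cvg_mx => i j.
under eq_fun do rewrite mxE; rewrite mxE; exact: cvg_entry.
Qed.

Lemma cvg_mulmx (R : realType) (T : Type) (F : set_system T) (FF : Filter F)
    m n p (g : T -> 'M[R]_(m, n)) (k : T -> 'M[R]_(n, p)) (M : 'M[R]_(m, n)) (N : 'M[R]_(n, p)) :
  g @ F --> M -> k @ F --> N -> (fun x => g x *m k x) @ F --> M *m N.
Proof.
move=> H1 H2; apply: cvg_mx => i j.
under eq_fun do rewrite mxE; rewrite mxE; apply: cvg_sumr => a.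
by apply: cvgM; exact: cvg_entry.
Qed.

Lemma cvg_det (R : realType) (T : Type) (F : set_system T) (FF : Filter F)
    n (g : T -> 'M[R]_n) (M : 'M[R]_n) :
  g @ F --> M -> (fun x => \det (g x)) @ F --> \det M.
Proof.
move=> H; apply: cvg_sumr => s; apply: cvgM; first exact: cvg_cst.
by apply: cvg_prodr => i; exact: cvg_entry.
Qed.

Lemma cvg_adj (R : realType) (T : Type) (F : set_system T) (FF : Filter F)
    n (g : T -> 'M[R]_n) (M : 'M[R]_n) :
  g @ F --> M -> (fun x => \adj (g x)) @ F --> \adj M.
Proof.
move=> H; apply: cvg_mx => i j.
under eq_fun do rewrite mxE; rewrite mxE.
apply: cvgM; first exact: cvg_cst.
apply: cvg_det; apply: cvg_mx => a b.
under eq_fun do rewrite !mxE; rewrite !mxE; exact: cvg_entry.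
Qed.

(** Cramer's formula reduces the claim to limits of [\det] and [\adj]. Invertibility at every x
    excludes the default value [invmx A = A] of singular matrices. *)
Lemma cvg_invmx (R : realType) (T : Type) (F : set_system T) (FF : Filter F)
    n (g : T -> 'M[R]_n) (M : 'M[R]_n) :
  (forall x, g x \in unitmx) -> M \in unitmx ->
  g @ F --> M -> (fun x => invmx (g x)) @ F --> invmx M.
Proof.
move=> Hu Mu H.
have -> : (fun x => invmx (g x)) = (fun x => (\det (g x))^-1 *: \adj (g x)).
  by apply/funext => x; rewrite /invmx Hu.
rewrite /invmx Mu; apply: cvgZ; last exact: cvg_adj.
apply: cvgV; last exact: cvg_det.
by move: Mu; rewrite unitmxE unitfE.
Qed.

(** The maximum norm is not submultiplicative: the inner dimension enters as a factor, whence the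
    powers of n and m in the later constants. *)
Lemma mulmx_norm_le (R : realType) m n p (A : 'M[R]_(m, n))
    (B : 'M[R]_(n, p)) : `|A *m B| <= n%:R * `|A| * `|B|.
Proof.
apply/mx_norm_leP; first by rewrite !mulr_ge0.
move=> i j; rewrite mxE; apply: le_trans (ler_norm_sum _ _ _) _.
have -> : n%:R * `|A| * `|B| = \sum_(k < n) (`|A| * `|B|).
  by rewrite sumr_const card_ord -mulrA mulr_natl.
by apply: ler_sum => k _; rewrite normrM ler_pM// mx_entry_le.
Qed.

(** * Limits of bounded sequences along ultrafilters *)

(** Relative compactness of bounded sequences without extraction: a single ultrafilter gives limits
    to a whole family of bounded sequences at once, so no diagonal argument is needed. *)
Definition ultra_complete (R : realType) (V : normedModType R) :=
  forall (U : set_system nat) (u : nat -> V) (M : R), UltraFilter U ->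
    (forall k, `|u k| <= M) -> exists l : V, u @ U --> l.

Lemma ultra_fmap (T S : Type) (U : set_system T) (u : T -> S) :
  UltraFilter U -> UltraFilter (u @ U).
Proof.
move=> UU; split; first exact: fmap_proper_filter.
move=> G GP UG; apply/seteqP; split => // A GA.
have [//|UA] := in_ultra_setVsetC (u @^-1` A) UU.
have : G (A `&` ~` A) by apply: filterI => //; exact: UG.
by rewrite setICr => /filter_not_empty.
Qed.

Lemma real_ultra_complete (R : realType) (U : set_system nat) (u : nat -> R)
    (M : R) : UltraFilter U ->
    (forall k, `|u k| <= M) -> exists l : R, u @ U --> l.
Proof.
move=> UU uM; have : compact `[- M, M]%classic by exact: segment_compact.
rewrite compact_ultra => H.
have UA : (u @ U) `[- M, M]%classic.
  rewrite /nbhs /= (_ : u @^-1` _ = setT); first exact: filterT.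
  by apply/seteqP; split => // k _ /=; rewrite in_itv /= -ler_norml.
by have [l [_ ul]] := H (u @ U) (ultra_fmap u UU) UA; exists l.
Qed.

Lemma mx_ultra_complete (R : realType) m n : @ultra_complete R 'M[R]_(m, n).
Proof.
move=> U u M UU uM.
have K (ij : 'I_m * 'I_n) : exists l : R, u k ij.1 ij.2 @[k --> U] --> l.
  apply: (@real_ultra_complete R U _ M) => k.
  exact: le_trans (mx_entry_le _ _ _) (uM k).
have [l Hl] := choice K.
exists (\matrix_(i, j) l (i, j)); apply: cvg_mx => i j.
by rewrite mxE; exact: (Hl (i, j)).
Qed.

Lemma pair_ultra_complete (R : realType) (V W : normedModType R) :
  @ultra_complete R V -> @ultra_complete R W ->
  @ultra_complete R (V * W)%type.
Proof.
move=> HV HW U u M UU uM.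
have [k|l1 H1] := HV U (fun k => (u k).1) M UU.
  by apply: le_trans (uM k); rewrite prod_normE /= le_max lexx.
have [k|l2 H2] := HW U (fun k => (u k).2) M UU.
  by apply: le_trans (uM k); rewrite prod_normE /= le_max lexx orbT.
exists (l1, l2).
have -> : u = (fun k => ((u k).1, (u k).2)).
  by apply/funext => k; case: (u k).
exact: cvg_pair.
Qed.

(** * Peano's existence theorem by Euler's method *)

Section euler.
Variables (R : realType) (V : normedModType R) (F : V -> V) (x0 : V).

Definition euler (tau : R) (k : nat) : V :=
  iter k (fun x => x + tau *: F x) x0.

(** The slope c is free: c = 0 gives the Lipschitz bound on the nodes, and c = F (x t) the
    derivative of the limit at t. *)
Lemma euler_dev tau c e i j : 0 <= tau -> (i <= j)%N ->
  (forall k, (i <= k < j)%N -> `|F (euler tau k) - c| <= e) ->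
  `|euler tau j - euler tau i - ((j%:R - i%:R) * tau) *: c|
    <= (j%:R - i%:R) * tau * e.
Proof.
move=> tau0; elim: j => [|j IH] ij H.
  by move: ij; rewrite leqn0 => /eqP ->; rewrite !subrr !mul0r scale0r subrr normr0.
move: ij; rewrite leq_eqVlt => /predU1P[->|].
  by rewrite !subrr !mul0r scale0r subrr normr0.
rewrite ltnS => ij.
have K : `|euler tau j - euler tau i - ((j%:R - i%:R) * tau) *: c|
    <= (j%:R - i%:R) * tau * e.
  apply: IH => // k /andP[ik kj]; apply: H; rewrite ik /=.
  exact: ltn_trans kj _.
have Hj := H j; rewrite ij ltnSn in Hj; have {}Hj := Hj isT.
have -> : euler tau j.+1 - euler tau i - ((j.+1%:R - i%:R) * tau) *: c =
    (euler tau j - euler tau i - ((j%:R - i%:R) * tau) *: c)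
    + tau *: (F (euler tau j) - c).
  have -> : (j.+1%:R - i%:R) * tau = (j%:R - i%:R) * tau + tau.
    by rewrite -natr1; ring.
  rewrite scalerDl scalerBr [euler tau j.+1]/=.
  set a := euler tau j; set b := euler tau i; set d := (_ * tau) *: c.
  set f := tau *: F a; set g := tau *: c.
  by rewrite opprD !addrA; congr (_ - _); rewrite -!addrA; congr (_ + _);
     rewrite [f + _]addrC -addrA.
apply: le_trans (ler_normD _ _) _.
have -> : (j.+1%:R - i%:R) * tau * e = (j%:R - i%:R) * tau * e + tau * e.
  by rewrite -natr1; ring.
apply: lerD => //; rewrite normrZ ger0_norm//; exact: ler_wpM2l.
Qed.

Lemma euler_lip tau B i j : 0 <= tau -> (forall x, `|F x| <= B) ->
  (i <= j)%N ->
  `|euler tau j - euler tau i| <= (j%:R - i%:R) * tau * B.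
Proof.
move=> tau0 FB ij; have := @euler_dev tau 0 B i j tau0 ij.
by rewrite scaler0 subr0; apply => k _; rewrite subr0.
Qed.

Definition mesh (N : nat) : R := N.+1%:R^-1.

(** A step function rather than a polygon: its jumps cost one extra mesh in each estimate, which
    vanishes in the limit. *)
Definition euler_path (N : nat) (t : R) : V :=
  euler (mesh N) (Num.truncn (t * N.+1%:R)).

Lemma mesh_gt0 N : 0 < mesh N. Proof. by rewrite invr_gt0. Qed.

Lemma truncn_mesh N (t : R) : 0 <= t ->
  (Num.truncn (t * N.+1%:R))%:R * mesh N <= t /\
  t <= (Num.truncn (t * N.+1%:R))%:R * mesh N + mesh N.
Proof.
move=> t0.
have /truncn_itv/andP[H1 H2] : 0 <= t * N.+1%:R by rewrite mulr_ge0.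
rewrite ler_pdivrMr//; split => //.
have -> : (Num.truncn (t * N.+1%:R))%:R * mesh N + mesh N =
  (Num.truncn (t * N.+1%:R)).+1%:R / N.+1%:R by rewrite -[X in _ = X / _]natr1 mulrDl mul1r.
by rewrite ler_pdivlMr// ltW.
Qed.

Lemma truncn_mesh_le N (s t : R) : 0 <= s -> s <= t ->
  (Num.truncn (s * N.+1%:R) <= Num.truncn (t * N.+1%:R))%N.
Proof. by move=> s0 st; apply: le_truncn; rewrite ler_wpM2r. Qed.

End euler.

Section peano.
Variables (R : realType) (V : normedModType R) (F : V -> V) (x0 : V) (B : R).
Hypothesis Vc : @ultra_complete R V.
Hypothesis Fc : continuous F.
Hypothesis FB : forall x, `|F x| <= B.

Let B0 : 0 <= B. Proof. exact: le_trans (normr_ge0 _) (FB 0). Qed.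

Lemma euler_path_lip N (s t : R) : 0 <= s -> s <= t ->
  `|euler_path F x0 N t - euler_path F x0 N s| <= (t - s + mesh R N) * B.
Proof.
move=> s0 st; have t0 := le_trans s0 st.
have m0 := ltW (mesh_gt0 R N).
apply: le_trans (euler_lip x0 m0 FB (truncn_mesh_le N s0 st)) _.
apply: ler_wpM2r => //.
have [h1 h2] := truncn_mesh N s0; have [h3 h4] := truncn_mesh N t0.
rewrite mulrBl; lra.
Qed.

(** The nodes between s1 and s2 are within d / 2 of the node at t, itself within d / 2 of xt, so F
    is e-close to c at all of them. The last term pays for replacing the time span of the nodes by
    s2 - s1, from which it differs by at most one mesh. *)
Lemma euler_path_dev N (s1 s2 t e d : R) (c xt : V) : 0 <= e ->
  0 <= s1 -> s1 <= t -> t <= s2 ->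
  (forall y, `|xt - y| < d -> `|F y - c| <= e) ->
  `|xt - euler_path F x0 N t| < d / 2 ->
  (s2 - s1 + mesh R N) * B < d / 2 ->
  `|euler_path F x0 N s2 - euler_path F x0 N s1 - (s2 - s1) *: c|
    <= (s2 - s1 + mesh R N) * e + mesh R N * `|c|.
Proof.
move=> e0 s10 s1t ts2 Hc Hx HB.
have m0 := ltW (mesh_gt0 R N).
have t0 := le_trans s10 s1t; have s20 := le_trans t0 ts2.
have i1 := truncn_mesh_le N s10 s1t; have i2 := truncn_mesh_le N t0 ts2.
have [h1 h2] := truncn_mesh N s10; have [h3 h4] := truncn_mesh N t0.
have [h5 h6] := truncn_mesh N s20.
rewrite /euler_path in Hx *.
set i := Num.truncn (s1 * _) in i1 h1 h2 *.
set j := Num.truncn (s2 * _) in i2 h5 h6 *.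
set l := Num.truncn (t * _) in i1 i2 h3 h4 Hx *.
set E := euler F x0 (mesh R N) in Hx *.
have jiB : (j%:R - i%:R) * mesh R N <= s2 - s1 + mesh R N.
  by rewrite mulrBl; lra.
have near k : (i <= k < j)%N -> `|F (E k) - c| <= e.
  move=> /andP[ik kj]; apply: Hc.
  have Ekl : `|E l - E k| <= (s2 - s1 + mesh R N) * B.
    have [kl|lk] := leqP k l.
      apply: le_trans (euler_lip x0 m0 FB kl) _; apply: ler_wpM2r => //.
      apply: le_trans jiB; apply: ler_wpM2r => //; apply: lerB; by rewrite ler_nat.
    rewrite distrC; apply: le_trans (euler_lip x0 m0 FB (ltnW lk)) _.
    apply: ler_wpM2r => //; apply: le_trans jiB; apply: ler_wpM2r => //.
    by apply: lerB; rewrite ler_nat// ltnW.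
  rewrite -(subrKA (E l)) (splitr d).
  by apply: le_lt_trans (ler_normD _ _) _; apply: ltrD => //; exact: le_lt_trans HB.
have dev := euler_dev m0 (leq_trans i1 i2) near.
have -> : E j - E i - (s2 - s1) *: c = (E j - E i - ((j%:R - i%:R) * mesh R N) *: c)
   + ((j%:R - i%:R) * mesh R N - (s2 - s1)) *: c.
  by rewrite [in RHS]scalerBl addrA subrK.
apply: le_trans (ler_normD _ _) _; apply: lerD.
  by apply: le_trans dev _; exact: ler_wpM2r.
rewrite normrZ; apply: ler_wpM2r => //; rewrite ler_norml mulrBl; lra.
Qed.

(** Pointwise limits along an ultrafilter finer than the eventual filter replace the Arzela-Ascoli
    theorem; the equation is read off difference quotients, without integrals. *)
Theorem peano : exists2 x : R -> V, is_solution F +oo%E x & x 0 = x0.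
Proof.
have [U [UU ooU]] := ultraFilterLemma (@eventually_filter).
have UF : Filter U by exact: (@filter_filter _ U (@ultra_proper _ U UU)).
have UP : ProperFilter U by exact: ultra_proper.
have meshU : mesh R @ U --> (0 : R).
  apply: cvg_trans (@cvg_harmonic R); exact: cvg_app.
have /choice[x Hx] : forall t : R, exists l : V, 0 <= t -> euler_path F x0 N t @[N --> U] --> l.
  move=> t; have [t0|] := pselect (0 <= t); last by exists 0.
  have [N|l Hl] := @Vc U (fun N => euler_path F x0 N t) (`|x0| + (t + 1) * B) UU; last by exists l.
  have := euler_path_lip N (lexx 0) t0.
  rewrite {2}/euler_path mul0r truncn0 /= => H.
  rewrite -[euler_path _ _ _ _](subrK x0) addrC.
  apply: le_trans (ler_normD _ _) _; apply: lerD => //; apply: le_trans H _.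
  rewrite subr0; apply: ler_wpM2r => //; apply: lerD => //.
  by rewrite invf_le1// ler1n.
have x00 : x 0 = x0.
  have : (fun N => euler_path F x0 N 0) = (fun=> x0).
    by apply/funext => N; rewrite /euler_path mul0r truncn0.
  move=> E; have := Hx 0 (lexx _); rewrite E => H.
  by apply: (cvg_unique _ H) => //; exact: cvg_cst.
(* An estimate on intervals containing t: t = s1 = 0 gives right continuity at 0, and s1 = t or s2 =
   t the two one-sided derivatives. *)
have key (t e : R) : 0 <= t -> 0 < e -> exists2 eta : R, 0 < eta &
    forall s1 s2, 0 <= s1 -> s1 <= t -> t <= s2 -> s2 - s1 <= eta ->
      `|x s2 - x s1 - (s2 - s1) *: F (x t)| <= (s2 - s1) * e.
  move=> t0 e0; have /cvgrPdist_le /(_ _ e0) := (Fc : forall z, F y @[y --> z] --> F z) (x t).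
  move=> /nbhs_ballP[d /= d0 Hd].
  have B1 : 0 < B + 1 by rewrite ltr_pwDr.
  (* Once the mesh is below the same bound, (s2 - s1 + mesh) B is at most d / 4, hence below d / 2;
     B + 1 avoids a division by zero. *)
  exists (d / 8 / (B + 1)); first by rewrite !divr_gt0.
  move=> s1 s2 s10 s1t ts2 s21.
  have s20 := le_trans s10 (le_trans s1t ts2).
  have cvL : (fun N => `|euler_path F x0 N s2 - euler_path F x0 N s1 - (s2 - s1) *: F (x t)|) @ U
     --> `|x s2 - x s1 - (s2 - s1) *: F (x t)|.
    apply: cvg_norm; apply: cvgB; last exact: cvg_cst.
    by apply: cvgB; exact: Hx.
  have cvR : (fun N => (s2 - s1 + mesh R N) * e + mesh R N * `|F (x t)|) @ U
     --> (s2 - s1) * e.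
    have -> : (s2 - s1) * e = (s2 - s1 + 0) * e + 0 * `|F (x t)| by ring.
    apply: cvgD; apply: cvgM; try exact: cvg_cst => //.
      by apply: cvgD => //; exact: cvg_cst.
    by [].
  apply: (ler_cvg_to cvL cvR).
  have /cvgrPdist_lt H1 := Hx t t0.
  have /cvgrPdist_lt H2 := meshU.
  have d2 : 0 < d / 2 by rewrite divr_gt0.
  have d8 : 0 < d / 8 / (B + 1) by rewrite !divr_gt0.
  have {}H1 := H1 _ d2; have {}H2 := H2 _ d8.
  near=> N.
  have K1 : `|x t - euler_path F x0 N t| < d / 2 by near: N.
  have K2 : `|0 - mesh R N| < d / 8 / (B + 1) by near: N.
  rewrite sub0r normrN gtr0_norm ?mesh_gt0// in K2.
  apply: (@euler_path_dev N s1 s2 t e d (F (x t)) (x t) (ltW e0) s10 s1t ts2 _ K1).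
    by move=> y Hy; rewrite distrC; apply: Hd; rewrite -ball_normE.
  have K3 : (s2 - s1 + mesh R N) * (B + 1) <= d / 4.
    rewrite -ler_pdivlMr//.
    have -> : d / 4 / (B + 1) = d / 8 / (B + 1) + d / 8 / (B + 1) by field; rewrite gt_eqF.
    by apply: lerD => //; exact: ltW.
  have m0 := mesh_gt0 R N.
  have : 0 <= s2 - s1 + mesh R N by lra.
  nra.
exists x => //; split.
  apply/cvgrPdist_le => e e0.
  have [eta eta0 H] := key 0 1 (lexx _) ltr01.
  have C0 : 0 < `|F (x 0)| + 1 by rewrite ltr_pwDr.
  near=> s.
  have s0 : 0 < s by near: s; exact: nbhs_right_gt.
  have := H 0 s (lexx _) (lexx _) (ltW s0); rewrite subr0 mulr1 => K.
  rewrite distrC -[x s - x 0](subrK (s *: F (x 0))).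
  apply: le_trans (ler_normD _ _) _.
  have K1 : `|x s - x 0 - s *: F (x 0)| <= s.
    by apply: K; near: s; exact: nbhs_right_le.
  have K2 : s <= e / (`|F (x 0)| + 1).
    by near: s; apply: nbhs_right_le; rewrite divr_gt0.
  rewrite ler_pdivlMr// in K2.
  by rewrite normrZ gtr0_norm//; lra.
move=> t t0 _.
have D : (fun h : R => h^-1 *: ((x \o shift t) (h *: (1 : R)) - x t)) @ 0^' --> F (x t).
  apply/cvgrPdist_le => e e0.
  have [eta eta0 H] := key t e (ltW t0) e0.
  have me : 0 < Num.min eta t by rewrite lt_min eta0.
  near=> h.
  have h0 : h != 0 by near: h; exact: nbhs_dnbhs_neq.
  have hm : `|h| < Num.min eta t by near: h; exact: dnbhs0_lt.
  move: hm; rewrite lt_min => /andP[he ht].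
  rewrite /= /shift /= [h *: 1]mulr1.
  have -> : F (x t) - h^-1 *: (x (h + t) - x t) = - (h^-1 *: (x (h + t) - x t - h *: F (x t))).
    by rewrite [in RHS]scalerBr scalerA mulVf// scale1r opprB.
  rewrite normrN normrZ normfV ler_pdivrMl ?normr_gt0//.
  case: (ltgtP 0 h) => hs; last by rewrite -hs eqxx in h0.
    have := H t (h + t) (ltW t0) (lexx _).
    rewrite addrK gtr0_norm// in he *; apply; last exact: ltW.
    by rewrite lerDr ltW.
  rewrite ltr0_norm// in he ht *.
  have := H (h + t) t.
  have -> : t - (h + t) = - h by ring.
  rewrite scaleNr opprK => K.
  rewrite -normrN !opprD !opprK [- _ + x t]addrC; apply: K => //; lra.
split; first by apply/cvg_ex; exists (F (x t)).
exact: cvg_lim.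
Unshelve. all: by end_near.
Qed.
End peano.

(** * Solutions at time 0 and trapping of real functions *)

Lemma continuous_ballP (R : realType) (V W : normedModType R) (f : V -> W)
    (x : V) :
  {for x, continuous f} <-> (forall e, 0 < e -> exists2 d, 0 < d &
    forall y, `|x - y| < d -> `|f x - f y| <= e).
Proof.
split=> [/cvgrPdist_le H e e0|H].
  have /nbhs_ballP[d /= d0 Hd] := H e e0.
  by exists d => // y xy; apply: Hd; rewrite -ball_normE.
apply/cvgrPdist_le => e e0; have [d d0 Hd] := H e e0.
by apply/nbhs_ballP; exists d => // y; rewrite -ball_normE /=; exact: Hd.
Qed.

Section solution_extension.
Variables (R : realType) (V : normedModType R).

(* Freezing a solution at negative times makes it two-sided continuous at 0. *)
Definition freeze (x : R -> V) (t : R) : V := x (Num.max 0 t).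

Lemma freezeE x t : 0 <= t -> freeze x t = x t.
Proof. by move=> t0; rewrite /freeze max_r. Qed.

Lemma freeze_continuous (F : V -> V) (T : \bar R) (x : R -> V) (t : R) :
  is_solution F T x -> (t%:E < T)%E -> {for t, continuous (freeze x)}.
Proof.
move=> [x0 xd] tT; apply/continuous_ballP => e e0.
case: (ltgtP t 0) => [t0|t0|t0].
- exists (- t) => [|s ts]; first by rewrite oppr_gt0.
  have s0 : s < 0 by have := ler_norm (s - t); rewrite distrC; lra.
  by rewrite /freeze (max_l (ltW t0)) (max_l (ltW s0)) subrr normr0 ltW.
- have /continuous_ballP/(_ _ e0)[d d0 Hd] : {for t, continuous x}.
    apply: differentiable_continuous; apply/derivable1_diffP.
    by have [] := xd t t0 tT.
  exists (Num.min d t) => [|s]; first by rewrite lt_min d0.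
  rewrite lt_min => /andP[sd st].
  have s0 : 0 < s by have := ler_norm (t - s); lra.
  by rewrite (freezeE _ (ltW t0)) (freezeE _ (ltW s0)); exact: Hd.
- move/cvgrPdist_le : x0 => /(_ _ e0) [d /= d0 Hd].
  exists d => // s; rewrite t0 => Hs.
  rewrite freezeE ?lexx//; have [s0|s0] := leP s 0.
    by rewrite /freeze (max_l s0) subrr normr0 ltW.
  by rewrite (freezeE _ (ltW s0)); apply: Hd.
Qed.

End solution_extension.

(** Continuous induction. At the supremum a of the times up to which q stays below r', continuity
    and the gap r' < r keep q below r slightly beyond a; the hypothesis improves this to r', against
    the choice of a. *)
Lemma trap (R : realType) (q : R -> R) (T : \bar R) (r r' : R) :
  r' < r -> (forall t, 0 <= t -> (t%:E < T)%E -> {for t, continuous q}) ->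
  q 0 <= r' ->
  (forall t, 0 < t -> (t%:E < T)%E -> (forall s, 0 <= s -> s < t -> q s <= r) ->
    forall s, 0 <= s -> s < t -> q s <= r') ->
  forall t, 0 <= t -> (t%:E < T)%E -> q t <= r'.
Proof.
move=> rr qc q0 H t1 t10 t1T; rewrite leNgt; apply/negP => qt1.
pose A : set R := [set t | 0 <= t <= t1 /\ forall s, 0 <= s -> s <= t -> q s <= r'].
have A0 : A 0.
  split; first by rewrite lexx.
  by move=> s s0 s0'; have -> : s = 0 by apply/eqP; rewrite eq_le s0 s0'.
have Aub : ubound A t1 by move=> t [/andP[]].
have supA : has_sup A by split; [exists 0 | exists t1].
set a := sup A.
have a0 : 0 <= a by exact: (ub_le_sup supA.2).
have at1 : a <= t1 by apply: ge_sup => //; exists 0.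
have aT : (a%:E < T)%E by apply: le_lt_trans t1T; rewrite lee_fin.
have below s : 0 <= s -> s < a -> q s <= r'.
  move=> s0 sa; have as0 : 0 < a - s by lra.
  have [t [_ At] st] := sup_adherent as0 supA.
  by apply: At => //; apply: ltW; move: st; rewrite opprB addrC subrK.
have qa : q a <= r'.
  rewrite leNgt; apply/negP => qa.
  have qa2 : 0 < (q a - r') / 2 by rewrite divr_gt0 ?subr_gt0.
  have /continuous_ballP/(_ _ qa2)[d d0 Hd] := qc a a0 aT.
  have [a00|a00] := eqVneq a 0; first by move: qa; rewrite a00 ltNge q0.
  have a0' : 0 < a by rewrite lt_neqAle eq_sym a00.
  pose s := Num.max 0 (a - d / 2).
  have sa : s < a by rewrite gt_max a0' /=; lra.
  have s0 : 0 <= s by rewrite le_max lexx.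
  have : `|a - s| < d.
    rewrite gtr0_norm ?subr_gt0//.
    have : a - d / 2 <= s by rewrite le_max lexx orbT.
    lra.
  move=> /Hd K; have := below s s0 sa.
  have := ler_norm (q a - q s); have := qa2; lra.
have {}at1 : a < t1.
  by rewrite lt_neqAle at1 andbT; apply: contraTneq qt1 => <-; rewrite -leNgt.
have rr2 : 0 < r - r' by rewrite subr_gt0.
have /continuous_ballP/(_ _ rr2)[d d0 Hd] := qc a a0 aT.
pose b := Num.min (a + d) t1.
have ab : a < b by rewrite lt_min at1 andbT ltrDl.
have bt1 : b <= t1 by rewrite ge_min lexx orbT.
have bT : (b%:E < T)%E by apply: le_lt_trans t1T; rewrite lee_fin.
have Hb s : 0 <= s -> s < b -> q s <= r'.
  apply: (H b _ bT); first exact: le_lt_trans ab.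
  move=> s' s0' sb; have [sa|sa] := ltP s' a.
    by apply: le_trans (ltW rr); exact: below.
  have : `|a - s'| < d.
    rewrite distrC ger0_norm ?subr_ge0//.
    have : b <= a + d by rewrite ge_min lexx.
    by lra.
  move=> /Hd K; have := ler_norm (q s' - q a); rewrite distrC; lra.
have : A ((a + b) / 2).
  split; first by apply/andP; split; lra.
  by move=> s s0 sab; apply: Hb => //; lra.
move=> /(ub_le_sup supA.2); rewrite -/a; lra.
Qed.

(** If q b > M, let c be the last time with q c <= M. After c the function exceeds M, so its
    derivative is nonpositive there and the mean value theorem gives q b <= q c. *)
Lemma barrier (R : realType) (q dq : R -> R) (a b M : R) : a <= b ->
  (forall t, a <= t <= b -> {for t, continuous q}) ->
  (forall t, a < t < b -> is_derive t 1 q (dq t)) ->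
  (forall t, a < t < b -> M <= q t -> dq t <= 0) ->
  q a <= M -> q b <= M.
Proof.
move=> ab qc qd H qa; rewrite leNgt; apply/negP => qb.
pose A : set R := [set t | a <= t <= b /\ q t <= M].
have Aa : A a by split => //; rewrite lexx.
have supA : has_sup A by split; [exists a | exists b => t [/andP[]]].
set c := sup A.
have ac : a <= c by exact: (ub_le_sup supA.2).
have cb : c <= b by apply: ge_sup; [exists a | move=> t [/andP[]]].
have qcM : q c <= M.
  rewrite leNgt; apply/negP => qcM.
  have qcM2 : 0 < (q c - M) / 2 by rewrite divr_gt0 ?subr_gt0.
  have qcc : {for c, continuous q} by apply: qc; rewrite ac.
  move/continuous_ballP : qcc => /(_ _ qcM2)[d d0 Hd].
  have [t At ct] := sup_adherent d0 supA.
  have tc : t <= c by exact: (ub_le_sup supA.2).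
  have : `|c - t| < d by rewrite ger0_norm ?subr_ge0//; rewrite -/c in ct; lra.
  move=> /Hd K; have := ler_norm (q c - q t); case: At => _; have := qcM2; lra.
have {}cb : c < b.
  by rewrite lt_neqAle cb andbT; apply: contraTneq qb => <-; rewrite -leNgt.
have [||d] := @MVT R q dq c b cb.
- move=> t; rewrite in_itv /= => /andP[ct tb]; apply: qd.
  by rewrite tb andbT (le_lt_trans ac).
- apply: continuous_in_subspaceT => t; rewrite inE /= in_itv /= => /andP[ct tb].
  by apply: qc; rewrite tb (le_trans ac).
rewrite in_itv /= => /andP[cd db] E.
have : dq d <= 0.
  apply: H; first by rewrite db andbT (le_lt_trans ac).
  rewrite leNgt; apply/negP => qdM.
  have : A d by split; [rewrite (ltW db) andbT ltW// (le_lt_trans ac) | exact: ltW].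
  by move=> /(ub_le_sup supA.2); rewrite -/c leNgt cd.
have : 0 < b - c by lra.
nra.
Qed.

(** * Stability implies global existence nearby *)

Section retraction.
Variables (R : realType) (V : normedModType R) (xe : V) (r : R).
Hypothesis r0 : 0 < r.

(** The radial retraction onto the closed ball. The maximum merges the inner and outer cases into
    one formula with a positive denominator, so continuity needs no gluing. *)
Definition ball_retract (x : V) : V :=
  xe + (r / Num.max r `|x - xe|) *: (x - xe).

Let m0 x : 0 < Num.max r `|x - xe|. Proof. by rewrite lt_max r0. Qed.

Lemma ball_retract_le x : `|ball_retract x - xe| <= r.
Proof.
rewrite /ball_retract addrC addKr normrZ ger0_norm; last first.
  by rewrite divr_ge0// ltW.
by rewrite mulrAC ler_pdivrMr// ler_wpM2l ?(ltW r0)// le_max lexx orbT.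
Qed.

Lemma ball_retract_id x : `|x - xe| <= r -> ball_retract x = x.
Proof.
by move=> H; rewrite /ball_retract max_l// divff ?gt_eqF// scale1r addrC subrK.
Qed.

Lemma ball_retract_continuous : continuous ball_retract.
Proof.
move=> x; apply: cvgD; first exact: cvg_cst.
have D : (fun y : V => y - xe) @ x --> x - xe by apply: cvgB; [exact: cvg_id | exact: cvg_cst].
apply: cvgZ => //; apply: cvgM; first exact: cvg_cst.
apply: cvgV; first by rewrite gt_eqF.
apply: (@continuous_max _ _ (fun=> r) (fun y => `|y - xe|)); first exact: cvg_cst.
exact: cvg_norm.
Qed.

End retraction.

(** The argument is not circular because stability speaks of solutions on every [0, T[: it applies
    to the piece of the modified solution known to remain in the ball, and [trap] with radii r0 / 2
    < r0 extends this piece to all times. *)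
Lemma stable_complete (R : realType) (V : normedModType R) (F : V -> V) (xe : V) :
  @ultra_complete R V -> (\forall x \near xe, {for x, continuous F}) ->
  lyapunov_stable F xe -> locally_complete F xe.
Proof.
move=> Vc Fc Fs.
have Fe : {for xe, continuous F} by exact: (nbhs_singleton Fc).
have [r0 r00 Hr0] : exists2 r0 : R, 0 < r0 & forall x, `|x - xe| <= r0 ->
    {for x, continuous F} /\ `|F x| <= `|F xe| + 1.
  move/cvgrPdist_lt : Fe => /(_ _ ltr01) Fe.
  move/nbhs_ballP : Fc => [d1 /= d10 Hd1]; move/nbhs_ballP : Fe => [d2 /= d20 Hd2].
  pose d := Num.min d1 d2; have d0 : 0 < d by rewrite lt_min d10.
  have dd : d <= d1 /\ d <= d2 by rewrite !ge_min !lexx orbT.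
  exists (d / 2); first by rewrite divr_gt0.
  move=> x xd; have {}xd : `|xe - x| < d by rewrite distrC; lra.
  have H1 : {for x, continuous F}.
    by apply: Hd1; rewrite -ball_normE; apply: lt_le_trans xd dd.1.
  have H2 : `|F xe - F x| < 1.
    by apply: Hd2; rewrite -ball_normE; apply: lt_le_trans xd dd.2.
  split => //; rewrite -[F x](subrK (F xe)) addrC.
  by apply: le_trans (ler_normD _ _) _; rewrite lerD2l distrC ltW.
pose G := F \o ball_retract xe r0.
have Gc : continuous G.
  move=> x; apply: (@continuous_comp _ _ _ (ball_retract xe r0) F).
    exact: (@ball_retract_continuous _ _ xe r0 r00 x).
  by have [] := Hr0 _ (ball_retract_le xe r00 x).
have GB x : `|G x| <= `|F xe| + 1.
  by have [] := Hr0 _ (ball_retract_le xe r00 x).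
have r2 : 0 < r0 / 2 by rewrite divr_gt0.
have [del del0 Hdel] := Fs _ r2.
exists (Num.min del (r0 / 2)); first by rewrite lt_min del0.
move=> x0; rewrite lt_min => /andP[x0d x0r].
have [x Hx x00] := peano x0 Vc Gc GB.
(* Inside the ball the retraction is the identity, so the original equation holds. *)
have solT (T : \bar R) : (forall s, 0 <= s -> (s%:E < T)%E -> `|x s - xe| <= r0) ->
    is_solution F T x.
  move=> H; split; first by have [] := Hx.
  move=> t t0 tT; have [_ /(_ t t0 (ltry _))] := Hx.
  by rewrite /G /= ball_retract_id//; apply: H => //; exact: ltW.
exists x => //; apply: (solT) => s s0 _.
have : `|freeze x s - xe| <= r0 / 2; last by rewrite freezeE//; lra.
apply: (@trap R (fun t => `|freeze x t - xe|) +oo%E r0) => //; last by rewrite ltry.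
- lra.
- move=> t t0 tT; apply: cvg_norm; apply: cvgB; last exact: cvg_cst.
  exact: (freeze_continuous Hx tT).
- by rewrite freezeE// x00 ltW.
move=> t t0 _ H u u0 ut; rewrite freezeE//; apply: ltW.
apply: (Hdel t%:E) => //; last by rewrite x00.
apply: solT => v v0; rewrite lte_fin => vt.
by have := H v v0 vt; rewrite freezeE.
Qed.

(** * Differentials and chain rule *)

Lemma diff_jac (R : realType) (n m : nat) (h : 'cV[R]_n -> 'cV[R]_m)
    (x v : 'cV[R]_n) : differentiable h x -> 'd h x v = jac h x *m v.
Proof.
move=> hx; have E : v = \sum_j v j 0 *: delta_mx j 0.
  apply/colP => i; rewrite summxE (bigD1 i)//= !mxE !eqxx mulr1 big1 ?addr0// => j ji.
  by rewrite !mxE eq_sym (negbTE ji) mulr0.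
rewrite {1}E linear_sum; apply/colP => i; rewrite summxE mxE.
by apply: eq_bigr => j _; rewrite linearZ mxE mulrC mxE deriveE.
Qed.

Lemma is_derive_comp_diff (R : realType) (V W : normedModType R)
    (x : R -> V) (g : V -> W) (t : R) (dx : V) :
  is_derive t 1 x dx -> differentiable g (x t) ->
  is_derive t 1 (g \o x) ('d g (x t) dx).
Proof.
move=> [xd <-] gd.
have xd' : differentiable x t by apply/derivable1_diffP.
have D : differentiable (g \o x) t by exact: differentiable_comp.
split; first exact/derivable1_diffP.
by rewrite !deriveE// diff_comp.
Qed.

Lemma diff_expand (R : realType) (V W : normedModType R) (g : V -> W) (x : V) (e : R) :
  differentiable g x -> 0 < e ->
  exists2 d, 0 < d & forall y, `|x - y| < d ->
    `|g y - g x - 'd g x (y - x)| <= e * `|y - x|.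
Proof.
move=> gd e0.
have E := diff_locallyx gd.
set o := ('o_ _ _) in E.
have /nbhs_ballP[d /= d0 Hd] := @littleoP _ _ _ _ _ (fun k => k) o e e0.
exists d => // y xy.
have -> : g y = g x + 'd g x (y - x) + o (y - x).
  by rewrite -E; congr g; rewrite (subrK x y).
rewrite -addrA -opprD addrAC subrr add0r; apply: Hd.
by rewrite -ball_normE /= sub0r normrN distrC.
Qed.

(** * Orthogonal projection onto the kernel of a matrix of full row rank *)

Section projector.
Variables (R : realType) (m n : nat).
Implicit Type J : 'M[R]_(m, n).

Lemma sq_mx_eq0 (u : 'rV[R]_n) : u *m u^T = 0 -> u = 0.
Proof.
move=> /matrixP/(_ 0 0); rewrite !mxE.
under eq_bigr do rewrite mxE -expr2.
move=> /psumr_eq0P H; apply/rowP => i; rewrite mxE.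
by apply/eqP; rewrite -sqrf_eq0; apply/eqP; apply: H => // j _; exact: sqr_ge0.
Qed.

(** If v J J^T = 0, then v J has Euclidean square v J J^T v^T = 0, so v J = 0, and the rows of J are
    independent. *)
Lemma gram_unit J : \rank J = m -> J *m J^T \in unitmx.
Proof.
move=> rJ; rewrite -row_free_unit; apply: inj_row_free => v vJ.
have : (v *m J) *m (v *m J)^T = 0.
  by rewrite trmx_mul mulmxA -(mulmxA v) vJ mul0mx.
move=> /sq_mx_eq0 /eqP; rewrite mulmx_free_eq0; first by move/eqP.
by rewrite /row_free rJ.
Qed.

(** For J of full row rank this is the Moore-Penrose inverse, and [proj J] is the orthogonal
    projector onto the kernel of J. *)
Definition pinv J : 'M[R]_(n, m) := J^T *m invmx (J *m J^T).
Definition proj J : 'M[R]_n := 1%:M - pinv J *m J.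

Lemma mulmx_pinv J : \rank J = m -> J *m pinv J = 1%:M.
Proof. by move=> rJ; rewrite mulmxA mulmxV// gram_unit. Qed.

Lemma mulmx_proj J : \rank J = m -> J *m proj J = 0.
Proof. by move=> rJ; rewrite mulmxBr mulmx1 mulmxA mulmx_pinv// mul1mx subrr. Qed.

Lemma proj_tr J : \rank J = m -> proj J *m J^T = 0.
Proof.
move=> rJ; rewrite mulmxBl mul1mx -!mulmxA mulVmx ?gram_unit//.
by rewrite mulmx1 subrr.
Qed.

Lemma tr_proj J : (proj J)^T = proj J.
Proof.
rewrite /proj /pinv linearB /= trmx1 !trmx_mul trmxK trmx_inv trmx_mul trmxK.
by rewrite mulmxA.
Qed.

Lemma proj_idem J : \rank J = m -> proj J *m proj J = proj J.
Proof.
by move=> rJ; rewrite {1}/proj mulmxBl mul1mx -mulmxA mulmx_proj// mulmx0 subr0.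
Qed.

Lemma cvg_pinv (T : Type) (F : set_system T) (FF : Filter F)
    (J : T -> 'M[R]_(m, n)) (J0 : 'M[R]_(m, n)) :
  (forall x, \rank (J x) = m) -> \rank J0 = m -> J @ F --> J0 ->
  (fun x => pinv (J x)) @ F --> pinv J0.
Proof.
move=> rJ rJ0 H; apply: cvg_mulmx; first exact: cvg_trmx.
apply: cvg_invmx; rewrite ?gram_unit//; first by move=> x; exact: gram_unit.
by apply: cvg_mulmx => //; exact: cvg_trmx.
Qed.

Lemma cvg_proj (T : Type) (F : set_system T) (FF : Filter F)
    (J : T -> 'M[R]_(m, n)) (J0 : 'M[R]_(m, n)) :
  (forall x, \rank (J x) = m) -> \rank J0 = m -> J @ F --> J0 ->
  (fun x => proj (J x)) @ F --> proj J0.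
Proof.
move=> rJ rJ0 H; apply: cvgB; first exact: cvg_cst.
by apply: cvg_mulmx => //; exact: cvg_pinv.
Qed.

End projector.

(** * Euclidean inner product, Lagrangian gradient, coercivity *)

Section dot.
Variables (R : realType).

(** The norm on matrices is the maximum norm, whose square is not differentiable; the Euclidean
    square [dot u u] is what gets differentiated along solutions. *)
Definition dot n (u v : 'cV[R]_n) : R := (u^T *m v) 0 0.

Lemma dotE n (u v : 'cV[R]_n) : dot u v = \sum_i u i 0 * v i 0.
Proof. by rewrite /dot mxE; apply: eq_bigr => i _; rewrite mxE. Qed.

Lemma dotD n (u v w : 'cV[R]_n) : dot u (v + w) = dot u v + dot u w.
Proof. by rewrite /dot mulmxDr mxE. Qed.

Lemma dotN n (u v : 'cV[R]_n) : dot u (- v) = - dot u v.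
Proof. by rewrite /dot mulmxN mxE. Qed.

Lemma dotB n (u v w : 'cV[R]_n) : dot u (v - w) = dot u v - dot u w.
Proof. by rewrite dotD dotN. Qed.

Lemma dot_mulmx m n (u : 'cV[R]_m) (A : 'M[R]_(m, n)) (v : 'cV[R]_n) :
  dot u (A *m v) = dot (A^T *m u) v.
Proof. by rewrite /dot trmx_mul trmxK mulmxA. Qed.

Lemma dot_le n (u v : 'cV[R]_n) : `|dot u v| <= n%:R * `|u| * `|v|.
Proof.
rewrite dotE; apply: le_trans (ler_norm_sum _ _ _) _.
have -> : n%:R * `|u| * `|v| = \sum_(k < n) (`|u| * `|v|).
  by rewrite sumr_const card_ord -mulrA mulr_natl.
by apply: ler_sum => k _; rewrite normrM ler_pM// mx_entry_le.
Qed.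

Lemma dot_mulmx_le m n (u : 'cV[R]_m) (A : 'M[R]_(m, n)) (v : 'cV[R]_n) :
  `|dot u (A *m v)| <= m%:R * n%:R * `|A| * (`|u| * `|v|).
Proof.
apply: le_trans (dot_le _ _) _.
have -> : m%:R * n%:R * `|A| * (`|u| * `|v|) = m%:R * `|u| * (n%:R * `|A| * `|v|) by ring.
by rewrite ler_wpM2l ?mulr_ge0// mulmx_norm_le.
Qed.

Lemma dot_ge0 n (u : 'cV[R]_n) : 0 <= dot u u.
Proof. by rewrite dotE; apply: sumr_ge0 => i _; rewrite -expr2 sqr_ge0. Qed.

Lemma norm_le_dot n (u : 'cV[R]_n) (mu : R) : 0 <= mu ->
  dot u u <= mu ^+ 2 -> `|u| <= mu.
Proof.
move=> mu0 H; apply/mx_norm_leP => // i j; rewrite ord1.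
rewrite -(@ler_pXn2r _ 2)// ?nnegrE// real_normK ?num_real//.
apply: le_trans H; rewrite dotE (bigD1 i)//= -expr2 lerDl.
by apply: sumr_ge0 => k _; rewrite -expr2 sqr_ge0.
Qed.

(** The factor n + 1, in place of the sharp square root of n, needs no root and can be divided by
    even when n = 0. *)
Lemma dot_le_norm n (u : 'cV[R]_n) (mu : R) : 0 <= mu ->
  mu ^+ 2 <= dot u u -> mu <= n.+1%:R * `|u|.
Proof.
move=> mu0 H; rewrite -(@ler_pXn2r _ 2)// ?nnegrE ?mulr_ge0//.
apply: le_trans H _; apply: le_trans (ler_norm _) _; apply: le_trans (dot_le _ _) _.
rewrite exprMn !expr2 -mulrA ler_wpM2r ?mulr_ge0// -natrM ler_nat mulSn.
by rewrite (leq_trans (leqnSn n))// leq_addr.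
Qed.

Lemma is_derive_dot n (g : R -> 'cV[R]_n) (dg : 'cV[R]_n) (t : R) :
  is_derive t 1 g dg ->
  is_derive t 1 (fun s => dot (g s) (g s)) (2 * dot (g t) dg).
Proof.
move=> [gd <-].
have gi i : is_derive t 1 (fun s => g s i 0) ('D_1 g t i 0).
  split; first by move/derivable_mxP : gd.
  by rewrite derive_mx// mxE.
have -> : (fun s => dot (g s) (g s)) = \sum_(i < n) ((fun s => g s i 0) * (fun s => g s i 0)).
  by apply/funext => s; rewrite dotE fct_sumE.
apply: is_derive_eq; rewrite dotE mulr_sumr; apply: eq_bigr => i _.
by rewrite -[LHS]/(_ * _ + _ * _) mulrDl mul1r.
Qed.

End dot.

Lemma is_derive_mulmx (R : realType) m n (A : 'M[R]_(m, n)) (g : R -> 'cV[R]_n)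
    (dg : 'cV[R]_n) (t : R) :
  is_derive t 1 g dg -> is_derive t 1 (fun s => A *m g s) (A *m dg).
Proof.
move=> gd.
have Ac : continuous (mulmx A : 'cV[R]_n -> 'cV[R]_m).
  move=> x; apply: (@cvg_mulmx R _ (nbhs x) _ m n 1 (fun=> A) id).
    exact: cvg_cst.
  exact: cvg_id.
have := is_derive_comp_diff gd (linear_differentiable (g t) Ac).
by rewrite diff_lin.
Qed.

Lemma grad_lagrangian (R : realType) (n m : nat) (f : 'cV[R]_n -> R)
    (h : 'cV[R]_n -> 'cV[R]_m) (ls : 'cV[R]_m) (x : 'cV[R]_n) :
  differentiable f x -> differentiable h x ->
  grad (lagrangian f h ls) x = grad f x + (jac h x)^T *m ls.
Proof.
move=> fx hx; apply/colP => i; rewrite !mxE.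
have hd := diff_derivable (v := delta_mx i 0) hx.
have hk k : is_derive x (delta_mx i 0) (fun y => h y k 0)
    (('D_(delta_mx i 0) h x) k 0).
  split; first by move/derivable_mxP : hd.
  by rewrite derive_mx// mxE.
have fd : is_derive x (delta_mx i 0) f ('D_(delta_mx i 0) f x).
  exact/derivableP/diff_derivable.
have -> : lagrangian f h ls = f + \sum_(k < m) (ls k 0 *: (fun y => h y k 0)).
  apply/funext => y; rewrite /lagrangian mxE /= [RHS]/(_ + _) fct_sumE.
  by congr (_ + _); apply: eq_bigr => k _; rewrite mxE.
rewrite derive_val; congr (_ + _); apply: eq_bigr => k _.
by rewrite !mxE mulrC.
Qed.

(** Compactness of the unit sphere of the kernel: if no alpha = 1 / (N + 1) works, unit vectors of
    the kernel with form at most 1 / (N + 1) have an ultrafilter limit on which the form is not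
    positive. *)
Lemma coercive_on_kernel (R : realType) (m n : nat) (J : 'M[R]_(m, n))
    (H : 'M[R]_n) :
  (forall v, v != 0 -> J *m v = 0 -> 0 < dot v (H *m v)) ->
  exists2 alpha, 0 < alpha & forall v, J *m v = 0 ->
    alpha * `|v| ^+ 2 <= dot v (H *m v).
Proof.
move=> HJ; apply: contrapT => K.
have /choice[v Hv] : forall N : nat, exists v : 'cV[R]_n,
    [/\ `|v| = 1, J *m v = 0 & dot v (H *m v) <= N.+1%:R^-1].
  move=> N; apply: contrapT => L; apply: K.
  exists N.+1%:R^-1; first by rewrite invr_gt0.
  move=> v Jv; have [->|v0] := eqVneq v 0.
    by rewrite normr0 expr0n mulr0 mulmx0 dotE big1// => i _; rewrite mxE mul0r.
  rewrite leNgt; apply/negP => M; apply: L.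
  have nv : 0 < `|v| by rewrite normr_gt0.
  exists (`|v|^-1 *: v); split.
  - by rewrite normrZ normfV normr_id mulVf// gt_eqF.
  - by rewrite -scalemxAr Jv scaler0.
  rewrite /dot -!scalemxAr linearZ /= -scalemxAl !mxE.
  rewrite mulrA -expr2 exprVn ler_pdivrMl ?exprn_gt0// [leRHS]mulrC.
  by move: (ltW M); rewrite /dot mxE.
have [U [UU ooU]] := ultraFilterLemma (@eventually_filter).
have UF : Filter U by exact: (@filter_filter _ U (@ultra_proper _ U UU)).
have UP : ProperFilter U by exact: ultra_proper.
have [N|w Hw] := @mx_ultra_complete R n 1 U v 1 UU.
  by have [-> _ _] := Hv N.
have w1 : `|w| = 1.
  have : (fun N => `|v N|) = (fun=> 1) by apply/funext => N; have [] := Hv N.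
  move=> E; have := @cvg_norm _ _ _ U _ v w Hw; rewrite E => H1.
  by apply: (cvg_unique _ (H1 UF)) => //; exact: cvg_cst.
have Jw : J *m w = 0.
  have : (fun N => J *m v N) = (fun=> 0) by apply/funext => N; have [] := Hv N.
  have H0 : (fun N => J *m v N) @ U --> J *m w by apply: cvg_mulmx => //; exact: cvg_cst.
  move=> E; rewrite E in H0.
  by apply: (cvg_unique _ H0) => //; exact: cvg_cst.
have : 0 < dot w (H *m w).
  by apply: HJ => //; rewrite -normr_gt0 w1.
apply/negP; rewrite -leNgt.
have cvL : (fun N => dot (v N) (H *m v N)) @ U --> dot w (H *m w).
  apply: cvg_entry; apply: cvg_mulmx; first exact: cvg_trmx.
  by apply: cvg_mulmx => //; exact: cvg_cst.
have cvR : (fun N : nat => N.+1%:R^-1 : R) @ U --> (0 : R).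
  apply: cvg_trans (@cvg_harmonic R); exact: cvg_app.
apply: (ler_cvg_to cvL cvR); apply: nearW => N.
by have [] := Hv N.
Qed.

(** With eta = x - xs and g the Lagrangian gradient at x, the first term is the curvature along xi.
    The other four are errors: the normal part of eta, the linearization of g, the variation of the
    projector, and the input. *)
Lemma dot_proj_split (R : realType) (n : nat) (xi eta g w : 'cV[R]_n)
    (P Q H : 'M[R]_n) :
  dot xi (- (Q *m g) + w) =
    - dot xi (P *m (H *m xi)) - dot xi (P *m H *m (eta - xi))
    - dot xi (P *m (g - H *m eta)) + dot xi ((P - Q) *m g) + dot xi w.
Proof.
rewrite dotD dotN mulmxBl !mulmxBr -!mulmxA !dotB.
move: (dot xi (P *m (H *m xi))) (dot xi (P *m (H *m eta))) => a b.
by move: (dot xi (P *m g)) (dot xi (Q *m g)) (dot xi w) => u v z; ring.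
Qed.

(** Here q2 = |xi|^2 and q1 = mu^2 / (n + 1)^2. The errors consume half of alpha q2, and the factor
    2 from differentiating a square restores alpha q2. *)
Lemma decay_arith (R : realFieldType)
    (alpha a1 a2 a3 a4 e q1 q2 t1 t2 t3 t4 t5 : R) :
  (a1 + a2 + a3 + a4) * e * q2 <= alpha / 2 * q2 -> alpha * q2 <= t1 ->
  - (a1 * e * q2) <= t2 -> - (a2 * e * q2) <= t3 -> t4 <= a3 * e * q2 ->
  t5 <= a4 * e * q2 -> alpha * q1 <= alpha * q2 ->
  2 * (- t1 - t2 - t3 + t4 + t5) <= - (alpha * q1).
Proof. lra. Qed.

(** * Estimates near the stationary point *)

Section local_estimates.
Variables (R : realType) (n m : nat) (f : 'cV[R]_n -> R)
  (h : 'cV[R]_n -> 'cV[R]_m) (xs : 'cV[R]_n) (ls : 'cV[R]_m).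
Hypothesis hf : forall x, differentiable f x.
Hypothesis hh : forall x, differentiable h x.
Hypothesis hf2 : differentiable (grad f) xs.
Hypothesis hh2 : differentiable (jac h) xs.
Hypothesis hrank : forall x, \rank (jac h x) = m.
Hypothesis hstat : stationary f h xs ls.
Hypothesis hsosc : second_order_sufficient f h xs ls.

Let D (x : 'cV[R]_n) : 'cV[R]_n := grad f x + (jac h x)^T *m ls.
Let J0 := jac h xs.
Let P0 := proj J0.
Let I0 := pinv J0.
Let H0 := hessian (lagrangian f h ls) xs.

(** Valid off the constraint set too, where v adds a normal component. The gain is that D vanishes
    at xs, whereas grad f need not. *)
Lemma flcmo_inputE x v :
  flcmo_input f h x v = - (proj (jac h x) *m D x) + pinv (jac h x) *m v.
Proof.
rewrite /flcmo_input mulmxDr -/(pinv _) addrA; congr (_ + _).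
rewrite /D mulmxDr (mulmxA (proj _)) proj_tr// mul0mx addr0.
by rewrite mulmxBl mul1mx mulmxA opprB addrC.
Qed.

(** Exact feedback linearization: with the chain rule it gives y' = v for y = h x. *)
Lemma jac_flcmo_input x v : jac h x *m flcmo_input f h x v = v.
Proof.
rewrite flcmo_inputE mulmxDr mulmxN (mulmxA _ (proj _)) mulmx_proj// mul0mx.
by rewrite oppr0 add0r (mulmxA _ (pinv _)) mulmx_pinv// mul1mx.
Qed.

Lemma grad_lagrangian_stationary : D xs = 0.
Proof. by have [] := hstat. Qed.

Lemma constraint_stationary : h xs = 0. Proof. by have [] := hstat. Qed.

Lemma grad_lagrangian_fun : grad (lagrangian f h ls) = D.
Proof. by apply/funext => x; exact: grad_lagrangian. Qed.

Lemma differentiable_grad_lagrangian : differentiable D xs.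
Proof.
apply: differentiableD => //.
pose phi : {linear 'M[R]_(m, n) -> 'cV[R]_n} := mulmxr ls \o trmx.
have phic : continuous phi.
  move=> A; apply: (@cvg_mulmx R _ (nbhs A) _ n m 1 (@trmx _ m n) (fun=> ls)).
    by apply: (@cvg_trmx R _ (nbhs A) _ m n id); exact: cvg_id.
  exact: cvg_cst.
apply: (@differentiable_comp _ _ _ _ (jac h) phi) => //.
exact: linear_differentiable.
Qed.

Lemma grad_lagrangian_expand e : 0 < e -> exists2 d, 0 < d &
  forall x, `|xs - x| < d -> `|D x - H0 *m (x - xs)| <= e * `|x - xs|.
Proof.
move=> e0; have [d d0 H] := diff_expand differentiable_grad_lagrangian e0.
exists d => // x /H; rewrite grad_lagrangian_stationary subr0.
rewrite diff_jac -?grad_lagrangian_fun// grad_lagrangian_fun.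
exact: differentiable_grad_lagrangian.
Qed.

Lemma constraint_expand e : 0 < e -> exists2 d, 0 < d &
  forall x, `|xs - x| < d -> `|h x - J0 *m (x - xs)| <= e * `|x - xs|.
Proof.
move=> e0; have [d d0 H] := diff_expand (hh xs) e0.
exists d => // x /H; rewrite constraint_stationary subr0.
by rewrite diff_jac.
Qed.

(** The projector is frozen at xs: the map is affine in x, so its derivative along a solution
    involves no derivative of [proj (jac h x)], and its values lie exactly in the kernel of J0. *)
Definition tangent x : 'cV[R]_n := P0 *m (x - xs).

Lemma sub_tangent x : x - xs - tangent x = I0 *m (J0 *m (x - xs)).
Proof. by rewrite /tangent /P0 /proj mulmxBl mul1mx opprB addrC subrK mulmxA. Qed.

Lemma jac_tangent x : J0 *m tangent x = 0.
Proof. by rewrite /tangent (mulmxA J0 P0) (mulmx_proj (hrank xs)) mul0mx. Qed.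

(** The normal part is I0 J0 (x - xs), and J0 (x - xs) equals h x up to a first-order remainder. *)
Lemma sub_tangent_bound e : 0 < e -> exists2 d, 0 < d & forall x, `|xs - x| < d ->
  `|x - xs - tangent x| <= m%:R * `|I0| * (`|h x| + e * `|x - xs|).
Proof.
move=> e0; have [d d0 H] := constraint_expand e0.
exists d => // x /H xd; rewrite sub_tangent.
apply: le_trans (mulmx_norm_le _ _) _; rewrite ler_wpM2l ?mulr_ge0//.
rewrite -[J0 *m _](subrK (h x)) addrC; apply: le_trans (ler_normD _ _) _.
by rewrite lerD2l distrC.
Qed.

Lemma distance_bound : exists2 C, 0 < C & exists2 d, 0 < d &
  forall x mu, `|xs - x| < d -> 0 <= mu -> dot (tangent x) (tangent x) <= mu ^+ 2 ->
    `|h x| <= mu -> `|x - xs| <= C * mu.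
Proof.
set c1 := m%:R * `|I0|; have c10 : 0 <= c1 by rewrite mulr_ge0.
(* This makes c1 e at most 1 / 2, so half of |x - xs| is absorbed on the left; hence the constant 2
   + 2 c1. *)
have e0 : 0 < (2 * c1 + 1)^-1 by rewrite invr_gt0; lra.
have [d d0 H] := sub_tangent_bound e0.
exists (2 + 2 * c1); first lra.
exists d => // x mu /H; rewrite -/c1 => Hx mu0 W hx.
have T := norm_le_dot mu0 W.
have ec : c1 * (2 * c1 + 1)^-1 <= 1 / 2.
  rewrite ler_pdivrMr; lra.
have N : `|x - xs| <= `|x - xs - tangent x| + `|tangent x|.
  by rewrite -{1}(subrK (tangent x) (x - xs)) ler_normD.
have K1 : c1 * ((2 * c1 + 1)^-1 * `|x - xs|) <= 1 / 2 * `|x - xs|.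
  by rewrite mulrA ler_wpM2r.
have K2 : c1 * `|h x| <= c1 * mu by rewrite ler_wpM2l.
rewrite mulrDr in Hx; lra.
Qed.

(** The constants c, k and d are chosen before mu, so the same ones serve all thresholds. *)
Lemma tangent_decay : exists2 c, 0 < c & exists2 k, 0 < k & exists2 d, 0 < d &
  forall x v mu, `|xs - x| < d -> 0 < mu ->
    mu ^+ 2 <= dot (tangent x) (tangent x) ->
    `|h x| <= k * mu -> `|v| <= k * mu ->
    2 * dot (tangent x) (P0 *m flcmo_input f h x v) <= - (c * mu ^+ 2).
Proof.
have [alpha alpha0 Halpha] : exists2 alpha, 0 < alpha & forall v, J0 *m v = 0 ->
    alpha * `|v| ^+ 2 <= dot v (H0 *m v).
  apply: coercive_on_kernel => v v0 Jv.
  by have := hsosc v0 Jv; rewrite /dot mulmxA.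
set c1 := m%:R * `|I0|; have c10 : 0 <= c1 by rewrite mulr_ge0.
set A1 := n%:R * n%:R * `|P0 *m H0|; have A10 : 0 <= A1 by rewrite !mulr_ge0.
set A2 := n%:R * n%:R * `|P0|; have A20 : 0 <= A2 by rewrite !mulr_ge0.
set B := n%:R * `|H0| + 1; have B1 : 0 <= B by rewrite addr_ge0// mulr_ge0.
set A3 : R := n%:R * n%:R * B * 3; have A30 : 0 <= A3 by rewrite !mulr_ge0.
set A4 := n%:R * m%:R * (`|I0| + 1); have A40 : 0 <= A4 by rewrite !mulr_ge0// addr_ge0.
(* One summand for each error term of [dot_proj_split]. *)
pose K := A1 * (4 * c1) + 3 * A2 + A3 + A4.
have K0 : 0 <= K by rewrite !addr_ge0// ?mulr_ge0//.
(* The bound 1 serves the estimate of D x, the second one absorbs |eta| in the normal part, and the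
   third makes the total error K e at most alpha / 2. *)
pose e := Num.min 1 (Num.min (2 * c1 + 1)^-1 (alpha / (2 * (K + 1)))).
have e0 : 0 < e.
  by rewrite !lt_min ltr01 invr_gt0 divr_gt0//; lra.
have e1 : e <= 1 by rewrite ge_min lexx.
have ec : e * (2 * c1 + 1) <= 1.
  have E : e <= (2 * c1 + 1)^-1 by rewrite !ge_min lexx !orbT.
  by rewrite -ler_pdivlMr ?div1r//; lra.
have eK : K * e <= alpha / 2.
  have : e <= alpha / (2 * (K + 1)) by rewrite !ge_min lexx !orbT.
  rewrite ler_pdivlMr; nra.
have [d1 d10 H1] := sub_tangent_bound e0.
have [d2 d20 H2] := grad_lagrangian_expand e0.
have jc : {for xs, continuous (jac h)} by exact: differentiable_continuous.
have [d3 d30 H3] : exists2 d, 0 < d & forall x, `|xs - x| < d ->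
    `|P0 - proj (jac h x)| <= e.
  have : {for xs, continuous (fun x => proj (jac h x))}
    by exact: (@cvg_proj R m n _ (nbhs xs) (nbhs_filter xs) (jac h) J0
      hrank (hrank xs) jc).
  by move/continuous_ballP/(_ _ e0).
have [d4 d40 H4] : exists2 d, 0 < d & forall x, `|xs - x| < d ->
    `|I0 - pinv (jac h x)| <= 1.
  have : {for xs, continuous (fun x => pinv (jac h x))}
    by exact: (@cvg_pinv R m n _ (nbhs xs) (nbhs_filter xs) (jac h) J0
      hrank (hrank xs) jc).
  by move/continuous_ballP/(_ _ ltr01).
have n0 : 0 < n.+1%:R :> R by [].
exists (alpha / n.+1%:R ^+ 2); first by rewrite divr_gt0// exprn_gt0.
(* Since mu <= (n + 1) |xi|, this k bounds h x and v by e |xi|. *)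
exists (e / n.+1%:R); first by rewrite divr_gt0.
exists (Num.min (Num.min d1 d2) (Num.min d3 d4)).
  by rewrite !lt_min d10 d20 d30 d40.
move=> x v mu; rewrite !lt_min => /andP[/andP[/H1 {}H1 /H2 {}H2] /andP[/H3 {}H3 /H4 {}H4]].
move=> mu0 W hx vx.
have Jx := jac_tangent x; have Px : P0^T *m tangent x = tangent x.
  by rewrite /tangent mulmxA tr_proj (proj_idem (hrank xs)).
(* The projector is symmetric and fixes xi, so it drops out of the inner product. *)
rewrite dot_mulmx Px flcmo_inputE.
move: H1 H2 W Jx Px; set xi := tangent x; set eta := x - xs => H1 H2 W Jx Px.
set s := `|xi|; have s0 : 0 <= s by exact: normr_ge0.
have mus : mu <= n.+1%:R * s by exact: dot_le_norm (ltW mu0) W.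
have ks : e / n.+1%:R * mu <= e * s.
  by rewrite mulrAC ler_pdivrMr// -mulrA ler_wpM2l ?(ltW e0)// mulrC.
have {}hx := le_trans hx ks; have {}vx := le_trans vx ks.
have N : `|eta| <= `|eta - xi| + s.
  by rewrite -{1}(subrK xi eta) ler_normD.
have eta0 := normr_ge0 eta.
rewrite -/c1 mulrDr in H1.
have F1 : c1 * `|h x| <= c1 * e * s by rewrite -mulrA ler_wpM2l.
have F2 : c1 * e <= 1 / 2 by lra.
have F3 : c1 * e * s <= 1 / 2 * s by rewrite ler_wpM2r.
have F4 : c1 * (e * `|eta|) <= 1 / 2 * `|eta| by rewrite mulrA ler_wpM2r.
(* The normal part is at most s / 2 + |eta| / 2, so |eta| is comparable to s; reinserting this shows
   that the normal part is of order e s. *)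
have eta3 : `|eta| <= 3 * s by lra.
have F5 : c1 * (e * `|eta|) <= c1 * e * (3 * s).
  rewrite [leLHS]mulrA; apply: ler_wpM2l => //; apply: mulr_ge0 => //; exact: ltW.
have etaxi : `|eta - xi| <= 4 * c1 * e * s by lra.
have DH : `|D x - H0 *m eta| <= 3 * e * s.
  apply: le_trans H2 _; have : e * `|eta| <= e * (3 * s) by rewrite ler_wpM2l// ltW.
  lra.
have Dx : `|D x| <= B * (3 * s).
  have : `|D x| <= `|D x - H0 *m eta| + `|H0 *m eta|.
    by rewrite -{1}(subrK (H0 *m eta) (D x)) ler_normD.
  have := mulmx_norm_le H0 eta.
  have : n%:R * `|H0| * `|eta| <= n%:R * `|H0| * (3 * s) by rewrite ler_wpM2l// mulr_ge0.
  have : e * s <= 1 * s by rewrite ler_wpM2r.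
  rewrite /B; lra.
have pinvx : `|pinv (jac h x)| <= `|I0| + 1.
  rewrite -[pinv _](subrK I0) addrC; apply: le_trans (ler_normD _ _) _.
  by rewrite lerD2l distrC.
have T1 : alpha * s ^+ 2 <= dot xi (P0 *m (H0 *m xi)).
  by rewrite dot_mulmx Px; exact: Halpha.
have T2 : `|dot xi (P0 *m H0 *m (eta - xi))| <= A1 * (4 * c1) * e * s ^+ 2.
  apply: le_trans (dot_mulmx_le _ _ _) _; rewrite -/A1 -/s.
  have -> : A1 * (4 * c1) * e * s ^+ 2 = A1 * (s * (4 * c1 * e * s)) by ring.
  by rewrite ler_wpM2l// ler_wpM2l.
have T3 : `|dot xi (P0 *m (D x - H0 *m eta))| <= 3 * A2 * e * s ^+ 2.
  apply: le_trans (dot_mulmx_le _ _ _) _; rewrite -/A2 -/s.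
  have -> : 3 * A2 * e * s ^+ 2 = A2 * (s * (3 * e * s)) by ring.
  by rewrite ler_wpM2l// ler_wpM2l.
have T4 : `|dot xi ((P0 - proj (jac h x)) *m D x)| <= A3 * e * s ^+ 2.
  apply: le_trans (dot_mulmx_le _ _ _) _; rewrite -/s.
  have -> : A3 * e * s ^+ 2 = n%:R * n%:R * e * (s * (B * (3 * s))) by rewrite /A3; ring.
  apply: ler_pM; rewrite ?mulr_ge0//; last by rewrite ler_wpM2l.
  by rewrite ler_wpM2l// mulr_ge0.
have T5 : `|dot xi (pinv (jac h x) *m v)| <= A4 * e * s ^+ 2.
  apply: le_trans (dot_mulmx_le _ _ _) _; rewrite -/s.
  have -> : A4 * e * s ^+ 2 = A4 * (s * (e * s)) by ring.
  apply: ler_pM; rewrite ?mulr_ge0//; last by rewrite ler_wpM2l.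
  by rewrite /A4 ler_wpM2l// mulr_ge0.
have Ks : K * e * s ^+ 2 <= alpha / 2 * s ^+ 2 by rewrite ler_wpM2r ?exprn_ge0.
have mu2 : mu ^+ 2 / n.+1%:R ^+ 2 <= s ^+ 2.
  rewrite ler_pdivrMr ?exprn_gt0// -exprMn lerXn2r// ?nnegrE ?mulr_ge0// ?(ltW mu0)//.
  by rewrite mulrC.
have Kq : alpha * (mu ^+ 2 / n.+1%:R ^+ 2) <= alpha * s ^+ 2 by rewrite ler_wpM2l// ltW.
have -> : alpha / n.+1%:R ^+ 2 * mu ^+ 2 = alpha * (mu ^+ 2 / n.+1%:R ^+ 2).
  by rewrite mulrAC mulrA.
rewrite (dot_proj_split xi eta (D x) _ P0 _ H0).
move: T2 T3 T4 T5; rewrite !ler_norml => /andP[T2 _] /andP[T3 _] /andP[_ T4] /andP[_ T5].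
exact: (decay_arith Ks T1 T2 T3 T4 T5 Kq).
Qed.

End local_estimates.

(** * Limits and derivatives in products *)

Section pairs.
Variables (R : realType) (V W : normedModType R).

Lemma fst_continuous : continuous (@fst V W).
Proof. by move=> [x y]; exact: cvg_fst. Qed.

Lemma snd_continuous : continuous (@snd V W).
Proof. by move=> [x y]; exact: cvg_snd. Qed.

Lemma cvg_pair_nbhs (T : Type) (F : set_system T) (FF : Filter F)
    (a : T -> V) (b : T -> W) (l : V) (l' : W) :
  a @ F --> l -> b @ F --> l' -> (fun x => (a x, b x)) @ F --> (l, l').
Proof. by move=> al bl; exact: cvg_pair. Qed.

Lemma is_derive_fst (s : R -> V * W) (ds : V * W) (t : R) :
  is_derive t 1 s ds -> is_derive t 1 (fun u => (s u).1) ds.1.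
Proof.
move=> sd; have := is_derive_comp_diff sd (linear_differentiable (s t) fst_continuous).
by rewrite (diff_lin _ fst_continuous).
Qed.

Lemma is_derive_snd (s : R -> V * W) (ds : V * W) (t : R) :
  is_derive t 1 s ds -> is_derive t 1 (fun u => (s u).2) ds.2.
Proof.
move=> sd; have := is_derive_comp_diff sd (linear_differentiable (s t) snd_continuous).
by rewrite (diff_lin _ snd_continuous).
Qed.

Lemma is_derive_pair (a : R -> V) (b : R -> W) (da : V) (db : W) (t : R) :
  is_derive t 1 a da -> is_derive t 1 b db ->
  is_derive t 1 (fun u => (a u, b u)) (da, db).
Proof.
move=> [ad <-] [bd <-].
have ad' : differentiable a t by exact/derivable1_diffP.
have bd' : differentiable b t by exact/derivable1_diffP.
have D : differentiable (fun u => (a u, b u)) t by exact: differentiable_pair.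
split; first exact/derivable1_diffP.
by rewrite !deriveE// diff_pair.
Qed.

Lemma pair_norm_lt (a : V) (b : W) (e : R) :
  (`|(a, b)| < e) = (`|a| < e) && (`|b| < e).
Proof. by rewrite prod_normE /= gt_max. Qed.

End pairs.

Lemma is_derive_freeze (R : realType) (V : normedModType R) (F : V -> V)
    (T : \bar R) (x : R -> V) (t : R) :
  is_solution F T x -> 0 < t -> (t%:E < T)%E ->
  is_derive t 1 (freeze x) (F (freeze x t)).
Proof.
move=> [_ xd] t0 tT; rewrite freezeE ?(ltW t0)//.
apply: near_eq_is_derive (xd t t0 tT).
have tpos : \forall s \near t, 0 < s by exact: lt_nbhsr.
by apply: filterS tpos => s s0; rewrite freezeE// ltW.
Qed.

(** * Solutions of the closed loop *)

Section closed_loop.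
Variables (R : realType) (n m p : nat) (f : 'cV[R]_n -> R)
  (h : 'cV[R]_n -> 'cV[R]_m) (xs : 'cV[R]_n) (ls : 'cV[R]_m)
  (G : controller R m p) (ze : 'cV[R]_p).
Hypothesis hf : forall x, differentiable f x.
Hypothesis hh : forall x, differentiable h x.
Hypothesis hf2 : \forall x \near xs, differentiable (grad f) x.
Hypothesis hh2 : \forall x \near xs, differentiable (jac h) x.
Hypothesis hrank : forall x, \rank (jac h x) = m.
Hypothesis hstat : stationary f h xs ls.
Hypothesis hsosc : second_order_sufficient f h xs ls.
Hypothesis hG : stabilizing_controller G ze.

Let F := flcmo f h G.
Let out (s : 'cV[R]_n * 'cV[R]_p) : 'cV[R]_m * 'cV[R]_p := (h s.1, s.2).
Let v s : 'cV[R]_m := ctrl_out G (out s).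
Let W (x : 'cV[R]_n) : R := dot (tangent h xs x) (tangent h xs x).

Let hc : continuous h.
Proof. by move=> x; exact: differentiable_continuous. Qed.

Lemma out_continuous : continuous out.
Proof.
move=> s; have c1 : (fun s' : 'cV[R]_n * 'cV[R]_p => h s'.1) @ s --> h s.1.
  exact: (cvg_comp _ _ (@fst_continuous R _ _ s) (@hc s.1)).
have c2 : (fun s' : 'cV[R]_n * 'cV[R]_p => s'.2) @ s --> s.2.
  exact: (@snd_continuous R _ _ s).
exact: (@cvg_pair_nbhs R _ _ _ (nbhs s) (nbhs_filter s) _ _ _ _ c1 c2).
Qed.

(** Transfers stability and attractivity of the integrator loop to the pair (h x, z) along any
    closed-loop solution. *)
Lemma out_solution T s : is_solution F T s ->
  is_solution (integrator_loop G) T (out \o s).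
Proof.
move=> [s0 sd]; split.
  exact: (cvg_comp _ _ s0 (@out_continuous (s 0))).
move=> t t0 tT; have sdt := sd t t0 tT.
have D1 := is_derive_comp_diff (is_derive_fst sdt) (hh (s t).1).
have D2 := is_derive_snd sdt.
have := is_derive_pair D1 D2; rewrite diff_jac// [(F _).1]/= (jac_flcmo_input f ls hrank).
by [].
Qed.

Lemma flcmo_continuous : \forall s \near (xs, ze), {for s, continuous F}.
Proof.
have [Gf Go _] := hG.
have K : \forall x \near xs, {for x, continuous (grad f)} /\ {for x, continuous (jac h)}.
  apply: filterS2 hf2 hh2 => x h1 h2; split; exact: differentiable_continuous.
have {}K : \forall s \near (xs, ze),
    {for s.1, continuous (grad f)} /\ {for s.1, continuous (jac h)}.
  exact: (@cvg_fst _ _ (nbhs xs) (nbhs ze) _ _ K).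
apply: filterS K => s [gc jc].
have c1 := @fst_continuous R 'cV[R]_n 'cV[R]_p s.
have oc := @out_continuous s.
have gs : (fun s' => grad f s'.1) @ s --> grad f s.1 by exact: (cvg_comp _ _ c1 gc).
have js : (fun s' => jac h s'.1) @ s --> jac h s.1 by exact: (cvg_comp _ _ c1 jc).
have vs : v @ s --> v s by exact: (cvg_comp _ _ oc (Go (out s))).
have zs : (fun s' => ctrl_field G (out s')) @ s --> ctrl_field G (out s).
  exact: (cvg_comp _ _ oc (Gf (out s))).
have FF := nbhs_filter s.
have ps := @cvg_pinv R m n _ (nbhs s) FF (fun s' => jac h s'.1) _ (fun _ => hrank _) (hrank _) js.
have jg := @cvg_mulmx R _ (nbhs s) FF m n 1 _ _ _ _ js gs.
have sum := @cvgD _ _ _ (nbhs s) FF _ _ _ _ jg vs.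
have pv := @cvg_mulmx R _ (nbhs s) FF n m 1 _ _ _ _ ps sum.
have gN := @cvgN _ _ _ (nbhs s) FF _ _ gs.
have tot := @cvgD _ _ _ (nbhs s) FF _ _ _ _ gN pv.
exact: (@cvg_pair_nbhs R _ _ _ (nbhs s) (nbhs_filter s) _ _ _ _ tot zs).
Qed.

Lemma integrator_loop_eq0 : ctrl_out G (0, ze) = 0 /\ ctrl_field G (0, ze) = 0.
Proof. by have [_ _ [[-> ->]]] := hG. Qed.

Lemma out_equilibrium : out (xs, ze) = (0, ze).
Proof. by rewrite /out /= (constraint_stationary hstat). Qed.

Lemma flcmo_equilibrium : F (xs, ze) = 0.
Proof.
have [g1 g2] := integrator_loop_eq0.
rewrite /F /flcmo /= (constraint_stationary hstat) g1 g2.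
rewrite (flcmo_inputE f ls hrank) (grad_lagrangian_stationary hstat).
by rewrite !mulmx0 oppr0 addr0.
Qed.

Lemma is_derive_tangent T s t : is_solution F T s -> 0 < t -> (t%:E < T)%E ->
  is_derive t 1 (fun u => W (freeze s u).1)
    (2 * dot (tangent h xs (freeze s t).1)
      (proj (jac h xs) *m flcmo_input f h (freeze s t).1 (v (freeze s t)))).
Proof.
move=> Hs t0 tT.
have D1 := is_derive_fst (is_derive_freeze Hs t0 tT).
have D2 : is_derive t 1 (fun u => (freeze s u).1 - xs) (F (freeze s t)).1.
  by apply: is_derive_eq; rewrite subr0.
exact: is_derive_dot (is_derive_mulmx (proj (jac h xs)) D2).
Qed.

Lemma W_continuous : continuous W.
Proof.
move=> x; have FF := nbhs_filter x.
have sub : (fun y => y - xs) @ x --> x - xs.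
  by apply: cvgB; [exact: cvg_id | exact: cvg_cst].
have tc := @cvg_mulmx R _ (nbhs x) FF n n 1 _ _ _ _ (@cvg_cst _ (proj (jac h xs)) _ _ FF) sub.
have td := @cvg_mulmx R _ (nbhs x) FF 1 n 1 _ _ _ _ (@cvg_trmx R _ _ FF n 1 _ _ tc) tc.
exact: (@cvg_entry R _ (nbhs x) FF 1 1 _ _ 0 0 td).
Qed.

Lemma W_freeze_continuous T s t : is_solution F T s -> (t%:E < T)%E ->
  {for t, continuous (fun u => W (freeze s u).1)}.
Proof.
move=> Hs tT.
have K := cvg_comp _ _ (freeze_continuous Hs tT) (@fst_continuous R _ _ (freeze s t)).
exact: (cvg_comp _ _ K (@W_continuous (freeze s t).1)).
Qed.

(** * Sublevel sets of W: invariance and finite-time entry *)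

Section confinement.
Variables (c k d mu : R).
Hypothesis c0 : 0 < c.
Hypothesis mu0 : 0 < mu.
Hypothesis decay : forall x v mu, `|xs - x| < d -> 0 < mu ->
  mu ^+ 2 <= dot (tangent h xs x) (tangent h xs x) ->
  `|h x| <= k * mu -> `|v| <= k * mu ->
  2 * dot (tangent h xs x) (proj (jac h xs) *m flcmo_input f h x v) <= - (c * mu ^+ 2).

(** An application of [barrier] at level mu^2. The starting time is free: stability uses 0,
    attractivity a time at which W has already dropped. *)
Lemma tangent_confined T s t0 t1 : is_solution F T s ->
  0 <= t0 -> t0 <= t1 -> (t1%:E < T)%E ->
  (forall t, t0 < t -> t < t1 ->
    [/\ `|xs - (s t).1| < d, `|h (s t).1| <= k * mu & `|v (s t)| <= k * mu]) ->
  W (s t0).1 <= mu ^+ 2 -> W (s t1).1 <= mu ^+ 2.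
Proof.
move=> Hs t00 t01 t1T H; rewrite -!(freezeE s)//; last exact: le_trans t01.
apply: (@barrier R (fun u => W (freeze s u).1) (fun t => 2 * dot (tangent h xs (freeze s t).1)
      (proj (jac h xs) *m flcmo_input f h (freeze s t).1 (v (freeze s t))))) => //.
- move=> t /andP[_ tt1]; apply: (W_freeze_continuous Hs).
  by apply: le_lt_trans t1T; rewrite lee_fin.
- move=> t /andP[tt0 tt1]; apply: (is_derive_tangent Hs).
    exact: le_lt_trans tt0.
  by apply: lt_trans t1T; rewrite lte_fin.
move=> t /andP[tt0 tt1] Wt.
have [h1 h2 h3] := H t tt0 tt1.
have E : freeze s t = s t by rewrite freezeE// ltW// (le_lt_trans t00).
rewrite E in Wt *; apply: le_trans (decay h1 mu0 Wt h2 h3) _.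
by rewrite oppr_le0 mulr_ge0// ?exprn_ge0// ltW.
Qed.

Lemma tangent_reaches s t0 : is_solution F +oo%E s -> 0 <= t0 ->
  (forall t, t0 < t ->
    [/\ `|xs - (s t).1| < d, `|h (s t).1| <= k * mu & `|v (s t)| <= k * mu]) ->
  exists2 t1, t0 <= t1 & W (s t1).1 <= mu ^+ 2.
Proof.
move=> Hs t00 H; apply: contrapT => K.
have Wbig t : t0 <= t -> mu ^+ 2 < W (s t).1.
  by move=> tt; rewrite ltNge; apply/negP => Wt; apply: K; exists t.
have cm : 0 < c * mu ^+ 2 by rewrite mulr_gt0// exprn_gt0.
(* Decreasing at rate c mu^2 for a time L costs W + 1, which would make W negative. *)
pose L := (W (s t0).1 + 1) / (c * mu ^+ 2).
have W0 x : 0 <= W x by exact: dot_ge0.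
have L0 : 0 < L by rewrite divr_gt0// ltr_wpDl.
have t0L : t0 < t0 + L by rewrite ltrDl.
have [||t] := @MVT R (fun u => W (freeze s u).1) (fun t => 2 * dot (tangent h xs (freeze s t).1)
      (proj (jac h xs) *m flcmo_input f h (freeze s t).1 (v (freeze s t)))) _ _ t0L.
- move=> t; rewrite in_itv /= => /andP[tt0 _]; apply: (is_derive_tangent Hs); last by rewrite ltry.
  exact: le_lt_trans tt0.
- apply: continuous_in_subspaceT => t _; apply: (W_freeze_continuous Hs).
  by rewrite ltry.
rewrite in_itv /= => /andP[tt0 tL].
have [h1 h2 h3] := H t tt0.
rewrite !freezeE ?(ltW (le_lt_trans t00 tt0))//; last by rewrite addr_ge0// ltW.
move=> E; have := decay h1 mu0 (ltW (Wbig t (ltW tt0))) h2 h3.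
rewrite [t0 + L]addrC addrK in E.
move: E; set dW := 2 * _ => E dWle.
have : dW * L <= - (c * mu ^+ 2) * L by rewrite ler_wpM2r// ltW.
rewrite -E mulNr [_ * L]mulrC /L divfK ?gt_eqF//.
have := W0 (s (L + t0)).1; lra.
Qed.

End confinement.

(** The input is small because [ctrl_out] is continuous and vanishes at the equilibrium. *)
Lemma out_near_equilibrium e : 0 < e -> exists2 d, 0 < d &
  forall w, `|w - (0, ze)| < d -> `|w.1| <= e /\ `|ctrl_out G w| <= e.
Proof.
move=> e0; have [_ Go _] := hG.
have Gc : {for (0, ze), continuous (ctrl_out G)} by exact: Go.
have [d d0 H] := (continuous_ballP _ _).1 Gc e e0.
exists (Num.min d e); first by rewrite lt_min d0.
move=> w; rewrite lt_min => /andP[wd we]; split.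
  by move: we; case: (w) => a b; rewrite pair_norm_lt /= subr0 => /andP[/ltW].
by have := H w; rewrite distrC (proj1 integrator_loop_eq0) sub0r normrN; apply.
Qed.

(* The trapping argument: [tangent_decay] confines the tangential part as long
   as [x] stays close to [xs], and [distance_bound] then keeps [x] even closer. *)
Lemma flcmo_lyapunov_stable : lyapunov_stable F (xs, ze).
Proof.
have [_ _ [_ Gs _ _]] := hG.
have [C C0 [d d0 dist]] := distance_bound hh hstat.
have [c c0 [k k0 [d' d'0 decay]]] := tangent_decay hf hh (nbhs_singleton hf2)
  (nbhs_singleton hh2) hrank hstat hsosc.
move=> eps eps0.
pose r := Num.min (Num.min d d') eps / 2.
have r0 : 0 < r by rewrite divr_gt0// !lt_min d0 d'0.
have rm : 2 * r = Num.min (Num.min d d') eps by rewrite /r mulrC divfK.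
have m1 : 2 * r <= d by rewrite rm !ge_min lexx.
have m2 : 2 * r <= d' by rewrite rm !ge_min lexx orbT.
have m3 : 2 * r <= eps by rewrite rm ge_min lexx orbT.
have [rd rd' re] : [/\ r < d, r < d' & r < eps] by split; lra.
(* With this mu, [distance_bound] returns r / 2, the improved radius that [trap] requires. *)
pose mu := r / 2 / C; have mu0 : 0 < mu by rewrite divr_gt0// divr_gt0.
have Cmu : C * mu = r / 2 by rewrite /mu mulrC divfK// gt_eqF.
(* The bound kap mu meets both requirements: k mu for [tangent_decay] and mu for
   [distance_bound]. *)
pose kap := Num.min k 1; have kap0 : 0 < kap by rewrite lt_min k0 ltr01.
have [kk k1] : kap <= k /\ kap <= 1 by rewrite !ge_min !lexx orbT.
have km0 : 0 < kap * mu by rewrite mulr_gt0.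
have [dv dv0 Hdv] := out_near_equilibrium km0.
(* The radius dv controls y and v, while eps controls the controller state. *)
have mn0 : 0 < Num.min dv eps by rewrite lt_min dv0.
have [d1 d10 Hd1] := Gs _ mn0.
have [d2 d20 Hd2] : exists2 d2, 0 < d2 & forall s,
    `|(xs, ze) - s| < d2 -> `|(0, ze) - out s| <= d1 / 2.
  have oc : {for (xs, ze), continuous out} by exact: out_continuous.
  have d12 : 0 < d1 / 2 by rewrite divr_gt0.
  by have := (continuous_ballP _ _).1 oc _ d12; rewrite out_equilibrium.
have [d3 d30 Hd3] : exists2 d3, 0 < d3 & forall x, `|xs - x| < d3 -> W x <= mu ^+ 2.
  have Wc : {for xs, continuous W} by exact: W_continuous.
  have mu2 : 0 < mu ^+ 2 by rewrite exprn_gt0.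
  have [d3 d30 H] := (continuous_ballP _ _).1 Wc _ mu2.
  exists d3 => // x /H.
  have -> : W xs = 0 by rewrite /W /tangent subrr mulmx0 /dot mulmx0 mxE.
  by rewrite sub0r normrN; apply: le_trans; exact: ler_norm.
exists (Num.min (Num.min d2 d3) (r / 2)); first by rewrite !lt_min d20 d30 divr_gt0.
move=> T s Hs; rewrite !lt_min => /andP[/andP[s2 s3] s4].
have s3' : `|(s 0).1 - xs| < d3 /\ `|(s 0).1 - xs| < r / 2.
  by move: s3 s4; case: (s 0) => a b /=; rewrite !pair_norm_lt /= => /andP[-> _] /andP[-> _].
have Hout t : 0 <= t -> (t%:E < T)%E -> `|out (s t) - (0, ze)| < Num.min dv eps.
  apply: (Hd1 T (out \o s)); first exact: out_solution.
  rewrite /= distrC; apply: le_lt_trans (Hd2 _ _) _; first by rewrite distrC.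
  lra.
have Hv t : 0 <= t -> (t%:E < T)%E -> `|h (s t).1| <= kap * mu /\ `|v (s t)| <= kap * mu.
  move=> t0 tT; have := Hout t t0 tT; rewrite lt_min => /andP[K _].
  by have [] := Hdv _ K.
have kkm : kap * mu <= k * mu by rewrite ler_wpM2r// ltW.
have k1m : kap * mu <= mu by rewrite -[leRHS]mul1r ler_wpM2r// ltW.
have Hx t : 0 <= t -> (t%:E < T)%E -> `|(freeze s t).1 - xs| <= r / 2.
  apply: (@trap R (fun t => `|(freeze s t).1 - xs|) T r) => //.
  - lra.
  - move=> {}t t0 tT; apply: cvg_norm; apply: cvgB; last exact: cvg_cst.
    exact: (cvg_comp _ _ (freeze_continuous Hs tT) (@fst_continuous R _ _ (freeze s t))).
  - by rewrite freezeE// ltW//; exact: s3'.2.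
  move=> {}t t0 tT H u u0 ut.
  have uT : (u%:E < T)%E by apply: lt_trans tT; rewrite lte_fin.
  rewrite freezeE// -Cmu; apply: dist; last 1 first.
  - by apply: le_trans k1m; have [] := Hv u u0 uT.
  - by rewrite distrC; apply: le_lt_trans rd; have := H u u0 ut; rewrite freezeE.
  - exact: ltW.
  apply: (@tangent_confined c k d' mu c0 mu0 decay T s 0 u Hs) => //; last first.
    by apply: Hd3; rewrite distrC; exact: s3'.1.
  move=> w w0 wu; have wT : (w%:E < T)%E by apply: lt_trans uT; rewrite lte_fin.
  have [v1 v2] := Hv w (ltW w0) wT; split; try exact: le_trans kkm.
  rewrite distrC; apply: le_lt_trans rd'; have := H w (ltW w0) (lt_trans wu ut).
  by rewrite freezeE// ltW.
move=> t t0 tT; have := Hout t t0 tT; have := Hx t t0 tT; rewrite freezeE// => K1 K2.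
move: K1 K2; rewrite /out; case: (s t) => a b /= K1.
rewrite lt_min !pair_norm_lt /= => /andP[_ /andP[_ ->]]; rewrite andbT; lra.
Qed.

Lemma flcmo_locally_attractive : locally_attractive F (xs, ze).
Proof.
have [_ _ [_ _ Ga _]] := hG.
have [dG dG0 HdG] := Ga.
have [C C0 [d d0 dist]] := distance_bound hh hstat.
have [c c0 [k k0 [d' d'0 decay]]] := tangent_decay hf hh (nbhs_singleton hf2)
  (nbhs_singleton hh2) hrank hstat hsosc.
have dd0 : 0 < Num.min d d' by rewrite lt_min d0.
(* Stability keeps x for all time in the neighbourhoods where both local estimates hold. *)
have [d1 d10 Hd1] := flcmo_lyapunov_stable dd0.
have [d2 d20 Hd2] : exists2 d2, 0 < d2 & forall s,
    `|(xs, ze) - s| < d2 -> `|(0, ze) - out s| <= dG / 2.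
  have oc : {for (xs, ze), continuous out} by exact: out_continuous.
  have dG2 : 0 < dG / 2 by rewrite divr_gt0.
  by have := (continuous_ballP _ _).1 oc _ dG2; rewrite out_equilibrium.
exists (Num.min d1 d2); first by rewrite lt_min d10.
move=> s Hs; rewrite lt_min => /andP[s1 s2].
have near_xs t : 0 <= t -> `|xs - (s t).1| < d /\ `|xs - (s t).1| < d'.
  move=> t0; have := Hd1 _ _ Hs s1 t t0 (ltry _).
  case: (s t) => a b /=; rewrite pair_norm_lt /= distrC => /andP[+ _].
  by rewrite lt_min => /andP.
have Hout : out (s t) @[t --> +oo] --> ((0, ze) : 'cV[R]_m * 'cV[R]_p).
  apply: (HdG (out \o s)); first exact: out_solution.
  rewrite /= distrC; apply: le_lt_trans (Hd2 _ _) _; first by rewrite distrC.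
  lra.
apply/cvgrPdist_le => eps eps0.
pose mu := eps / C; have mu0 : 0 < mu by rewrite divr_gt0.
have Cmu : C * mu = eps by rewrite /mu mulrC divfK// gt_eqF.
pose kap := Num.min k 1; have kap0 : 0 < kap by rewrite lt_min k0 ltr01.
have [kk k1] : kap <= k /\ kap <= 1 by rewrite !ge_min !lexx orbT.
have km0 : 0 < kap * mu by rewrite mulr_gt0.
have kkm : kap * mu <= k * mu by rewrite ler_wpM2r// ltW.
have k1m : kap * mu <= mu by rewrite -[leRHS]mul1r ler_wpM2r// ltW.
have [dv dv0 Hdv] := out_near_equilibrium km0.
have mn0 : 0 < Num.min dv eps by rewrite lt_min dv0.
move/cvgrPdist_lt : Hout => /(_ _ mn0) [T0 [_ HT0]].
pose t0 := Num.max 0 T0.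
have t00 : 0 <= t0 by rewrite le_max lexx.
have Hv t : t0 < t -> [/\ `|xs - (s t).1| < d', `|h (s t).1| <= k * mu & `|v (s t)| <= k * mu]
    /\ (`|h (s t).1| <= mu /\ `|(s t).2 - ze| <= eps).
  move=> tt; have tT0 : T0 < t by apply: le_lt_trans tt; rewrite le_max lexx orbT.
  have := HT0 t tT0; rewrite distrC lt_min => /andP[K1 K2].
  have [v1 v2] := Hdv _ K1; have t0' := ltW (le_lt_trans t00 tt).
  split; first by split; [exact: (near_xs t t0').2 | exact: le_trans kkm | exact: le_trans kkm].
  split; first exact: le_trans k1m.
  by move: K2; rewrite /out pair_norm_lt /= => /andP[_ /ltW].
(* After t0 the smallness of y and v is permanent: W falls to mu^2 at some t1 and cannot rise above
   it again. *)
have [t1 t01 Wt1] := @tangent_reaches c k d' mu c0 mu0 decay s t0 Hs t00 (fun t tt => (Hv t tt).1).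
exists t1; split; first exact: num_real.
move=> t t1t; have t0t := le_lt_trans t01 t1t; have [_ [ht zt]] := Hv t t0t.
have Wt : W (s t).1 <= mu ^+ 2.
  apply: (@tangent_confined c k d' mu c0 mu0 decay _ s t1 t Hs) => //.
  - exact: le_trans t01.
  - exact: ltW.
  - by rewrite ltry.
  by move=> u t1u _; have [] := Hv u (le_lt_trans t01 t1u).
have t0' := ltW (le_lt_trans t00 t0t).
have := dist _ _ (near_xs t t0').1 (ltW mu0) Wt ht; rewrite Cmu.
move: zt; case: (s t) => a b /= b1 a1.
by rewrite prod_normE /= ge_max (distrC xs) (distrC ze) a1 b1.
Qed.

End closed_loop.

Theorem theorem4 (R : realType) (n m p : nat)
    (f : 'cV[R]_n -> R) (h : 'cV[R]_n -> 'cV[R]_m)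
    (xs : 'cV[R]_n) (ls : 'cV[R]_m)
    (G : controller R m p) (ze : 'cV[R]_p)
    (hf : forall x : 'cV[R]_n, differentiable f x)
    (hh : forall x : 'cV[R]_n, differentiable h x)
    (hf2 : \forall x \near xs, differentiable (grad f) x)
    (hh2 : \forall x \near xs, differentiable (jac h) x)
    (hrank : forall x : 'cV[R]_n, \rank (jac h x) = m)
    (hstat : stationary f h xs ls)
    (hsosc : second_order_sufficient f h xs ls)
    (hG : stabilizing_controller G ze) :
  locally_asymptotically_stable (flcmo f h G) (xs, ze).
Proof.
split; first exact: flcmo_equilibrium hrank hstat hG.
- exact: (@flcmo_lyapunov_stable R n m p f h xs ls G ze).
- exact: (@flcmo_locally_attractive R n m p f h xs ls G ze).
apply: stable_complete.
- by apply: pair_ultra_complete; exact: mx_ultra_complete.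
- exact: (@flcmo_continuous R n m p f h xs G ze).
exact: (@flcmo_lyapunov_stable R n m p f h xs ls G ze).
Qed.
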